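(* Assume (A1)–(A4), that $\boldsymbol\Sigma_K$ is positive definite, and that the critical values satisfy the propagation conditions (PC) with parameters $r>0$, $\alpha\in(0,1]$ (all defined in the context). Let $\theta\in\mathbb R^p$ and let $\Delta\ge0$ be a finite constant (small modeling bias constant) such that $\Delta(1)\le\Delta$, and let $k^*=\max\{k\le K:\Delta(k)\le\Delta\}$ be the oracle index. Then $$\mathbb E\big|(\tilde\theta_{k^*}-\hat\theta)^\top B_{k^*}(\tilde\theta_{k^*}-\hat\theta)\big|^{r/2}\le \mathfrak z_{k^*}^{r/2}+(\alpha C(p,r))^{1/2}(1+\delta)^{pk^*/4}(1-\delta)^{-3pk^*/4}\exp\Big\{\varphi(\delta)\frac{\Delta}{2(1-\delta)}\Big\},$$ where $\varphi(\delta)=1$ in the case of homogeneous errors (that is, $\sigma_{0,i}=\sigma_0$ and $\sigma_i=\sigma$ for all $i$), and $\varphi(\delta)=\frac{2(1+\delta)}{(1-\delta)^2}-1$ otherwise; if $k^*=K$ the term $\mathfrak z_{k^*}^{r/2}$ is read as $0$.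
   Context: Model. Fix $x\in\mathbb R^d$, design points $X_1,\dots,X_n\in\mathbb R^d$, and $n>p$. One observes $Y=\mathbf f+\Sigma_0^{1/2}\varepsilon$, $\varepsilon\sim N(0,I_n)$, where $\mathbf f=(f(X_1),\dots,f(X_n))^\top$ for an unknown function $f$ and $\Sigma_0=\mathrm{diag}(\sigma_{0,1}^2,\dots,\sigma_{0,n}^2)$, $\sigma_{0,i}>0$, is unknown; $\mathbb E$ is the expectation under this model. $\Sigma=\mathrm{diag}(\sigma_1^2,\dots,\sigma_n^2)$, $\sigma_i>0$, is a known (possibly misspecified) covariance matrix. Estimators. Given basis functions $\psi_1,\dots,\psi_p$, put $\Psi_i=(\psi_1(X_i-x),\dots,\psi_p(X_i-x))^\top$ and let $\Psi$ be the $p\times n$ matrix with columns $\Psi_i$. For $k=1,\dots,K$ let $w_{k,i}\in[0,1]$ be weights (depending on $x$), $\mathcal W_k=\mathrm{diag}(w_{k,1},\dots,w_{k,n})$, $W_k=\Sigma^{-1/2}\mathcal W_k\Sigma^{-1/2}$, $B_k=\Psi W_k\Psi^\top$, $\tilde\theta_k=B_k^{-1}\Psi W_kY$ (the quasi maximum likelihood estimator), $\theta_k^*=B_k^{-1}\Psi W_k\mathbf f$. Assumptions. (A1) $\Psi\mathcal W_1$ has full row rank. (A2) $w_{l,i}\le w_{k,i}$ for all $i$ and $1\le l\le k\le K$. (A3) There is $\delta\in[0,1)$ with $1-\delta\le\sigma_{0,i}^2/\sigma_i^2\le1+\delta$ for all $i$. (A4) There are constants $1<u_0\le u$ with $u_0I_p\preceq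 B_{k-1}^{-1/2}B_kB_{k-1}^{-1/2}\preceq uI_p$ for $2\le k\le K$. ($A\preceq B$ means $B-A$ is nonnegative definite.) Adaptive procedure. For $l<m$ let $T_{lm}=(\tilde\theta_l-\tilde\theta_m)^\top B_l(\tilde\theta_l-\tilde\theta_m)$. Given positive critical values $\mathfrak z_1,\dots,\mathfrak z_{K-1}$, let $\hat k=\max\{k\le K: T_{lm}\le\mathfrak z_l \text{ for all } 1\le l<m\le k\}$ (so the first estimator is always accepted), $\hat\theta=\tilde\theta_{\hat k}$ and $\hat\theta_k=\tilde\theta_{\min\{k,\hat k\}}$. (PC): for given $\alpha\in(0,1]$, $r>0$, $\mathbb E_{0,\Sigma}|(\tilde\theta_k-\hat\theta_k)^\top B_k(\tilde\theta_k-\hat\theta_k)|^r\le\alpha C(p,r)$ for all $k=2,\dots,K$, where $\mathbb E_{0,\Sigma}$ is the expectation when $Y\sim N(0,\Sigma)$ and $C(p,r)=\mathbb E|\chi^2_p|^r=2^r\Gamma(r+p/2)/\Gamma(p/2)$. Modeling bias. $D_l=B_l^{-1}\Psi W_l$; $\mathbf D_k$ is the $pk\times nk$ block diagonal matrix with blocks $D_1,\dots,D_k$; $J_k$ is the $k\times k$ all-ones matrix; $\boldsymbol\Sigma_k=\mathbf D_k(J_k\otimes\Sigma)\mathbf D_k^\top$. With $b(k)=((\theta_1^*-\theta)^\top,\dots,(\theta_k^*-\theta)^\top)^\top\in\mathbb R^{pk}$, put $\Delta(k)=b(k)^\top\boldsymbol\Sigma_k^{-1}b(k)$. *)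

(* Defs.v *)
From HB Require Import structures.
From mathcomp Require Import all_boot all_order all_algebra.
From mathcomp Require Import all_classical all_reals all_analysis.

Set Implicit Arguments.
Unset Strict Implicit.
Unset Printing Implicit Defensive.

Import Order.TTheory GRing.Theory Num.Theory.
Import numFieldNormedType.Exports.

Local Open Scope classical_set_scope.
Local Open Scope ring_scope.

Definition qform (R : realType) (m : nat) (A : 'M[R]_m) (v : 'cV[R]_m) : R :=
  (v^T *m A *m v) 0 0.

Definition nonneg_def (R : realType) (m : nat) (A : 'M[R]_m) : Prop :=
  A^T = A /\ forall v : 'cV[R]_m, 0 <= qform A v.

Definition pos_def (R : realType) (m : nat) (A : 'M[R]_m) : Prop :=
  A^T = A /\ forall v : 'cV[R]_m, v != 0 -> 0 < qform A v.

Definition loewner_le (R : realType) (m : nat) (A B : 'M[R]_m) : Prop :=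
  nonneg_def (B - A).

(* The nonnegative definite square root (it exists and is unique when A is
   nonnegative definite); the default value is 0. *)
Definition sqrtmx (R : realType) (m : nat) (A : 'M[R]_m) : 'M[R]_m :=
  xget 0 [set S : 'M[R]_m | nonneg_def S /\ S *m S = A].

Definition diagf (R : realType) (n : nat) (a : 'I_n -> R) : 'M[R]_n :=
  diag_mx (\row_i a i).

Definition mutually_independent (disp : measure_display)
    (T : measurableType disp) (R : realType) (P : probability T R) (n : nat)
    (eps : 'I_n -> {RV P >-> R}) : Prop :=
  forall (J : {set 'I_n}) (A : 'I_n -> set R),
    (forall i, measurable (A i)) ->
    P (\bigcap_(i in [set` J]) (eps i @^-1` A i)) =
    (\prod_(i in J) P (eps i @^-1` A i))%E.

(* eps ~ N(0, I_n) *)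
Definition std_gaussian (disp : measure_display)
    (T : measurableType disp) (R : realType) (P : probability T R) (n : nat)
    (eps : 'I_n -> {RV P >-> R}) : Prop :=
  mutually_independent eps /\
  forall (i : 'I_n) (A : set R), measurable A ->
    distribution P (eps i) A = normal_prob 0 1 A.

(* The expectation of g(Y) for Y = mu + S^{1/2} eps with
   S = diag(s_1^2, ..., s_n^2), that is, for Y ~ N(mu, S). *)
Definition gaussE (disp : measure_display)
    (T : measurableType disp) (R : realType) (P : probability T R) (n : nat)
    (eps : 'I_n -> {RV P >-> R}) (mu : 'cV[R]_n) (s : 'I_n -> R)
    (g : 'cV[R]_n -> R) : \bar R :=
  'E_P[fun t => g (mu + diagf s *m (\col_i eps i t))].

Definition Gamma (R : realType) (s : R) : R :=
  \int[lebesgue_measure]_(t in `]0, +oo[) (t `^ (s - 1) * expR (- t)).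

(* E |chi^2_p|^r *)
Definition chi2_moment (R : realType) (p : nat) (r : R) : R :=
  2 `^ r * Gamma (r + p%:R / 2) / Gamma (p%:R / 2 : R).

(* Local estimation.  The scale index k ranges over 1, ..., K; families indexed
   by scales are functions on nat, used only at these values. *)

Definition design_mx (R : realType) (d n p : nat)
    (psi : 'I_p -> 'cV[R]_d -> R) (X : 'I_n -> 'cV[R]_d) (x : 'cV[R]_d)
    : 'M[R]_(p, n) :=
  \matrix_(j, i) psi j (X i - x).

Definition weight_mx (R : realType) (n : nat) (sigma : 'I_n -> R)
    (w : nat -> 'I_n -> R) (k : nat) : 'M[R]_n :=
  let Sigma_mhalf := diagf (fun i => (sigma i)^-1) in
  Sigma_mhalf *m diagf (w k) *m Sigma_mhalf.

Definition Bmx (R : realType) (n p : nat) (Psi : 'M[R]_(p, n))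
    (W : nat -> 'M[R]_n) (k : nat) : 'M[R]_p :=
  Psi *m W k *m Psi^T.

Definition Dmx (R : realType) (n p : nat) (Psi : 'M[R]_(p, n))
    (W : nat -> 'M[R]_n) (k : nat) : 'M[R]_(p, n) :=
  invmx (Bmx Psi W k) *m Psi *m W k.

(* thetat Psi W k Y is the quasi maximum likelihood estimator at scale k;
   at the vector of values of f it gives theta_k^*. *)
Definition thetat (R : realType) (n p : nat) (Psi : 'M[R]_(p, n))
    (W : nat -> 'M[R]_n) (k : nat) (y : 'cV[R]_n) : 'cV[R]_p :=
  Dmx Psi W k *m y.

Definition test_stat (R : realType) (n p : nat) (Psi : 'M[R]_(p, n))
    (W : nat -> 'M[R]_n) (l m : nat) (y : 'cV[R]_n) : R :=
  qform (Bmx Psi W l) (thetat Psi W l y - thetat Psi W m y).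

Definition khat (R : realType) (n p K : nat) (Psi : 'M[R]_(p, n))
    (W : nat -> 'M[R]_n) (z : nat -> R) (y : 'cV[R]_n) : nat :=
  (\max_(1 <= k < K.+1 |
     `[< forall l m : nat, (1 <= l)%N -> (l < m)%N -> (m <= k)%N ->
           (test_stat Psi W l m y <= z l)%R >]) k)%N.

Definition theta_hat (R : realType) (n p K : nat) (Psi : 'M[R]_(p, n))
    (W : nat -> 'M[R]_n) (z : nat -> R) (y : 'cV[R]_n) : 'cV[R]_p :=
  thetat Psi W (khat K Psi W z y) y.

Definition theta_hat_k (R : realType) (n p K : nat) (Psi : 'M[R]_(p, n))
    (W : nat -> 'M[R]_n) (z : nat -> R) (k : nat) (y : 'cV[R]_n) : 'cV[R]_p :=
  thetat Psi W (minn k (khat K Psi W z y)) y.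

(* D_k (J_k (x) Sigma) D_k^T, D_k = blockdiag(D_1, ..., D_k).  The Kronecker
   product J_k (x) Sigma is the k x k block matrix all of whose blocks are
   Sigma.  Block l : 'I_k (from 0) belongs to scale l.+1. *)
Definition joint_cov (R : realType) (n p : nat) (Psi : 'M[R]_(p, n))
    (W : nat -> 'M[R]_n) (Sigma : 'M[R]_n) (k : nat)
    : 'M[R]_(\sum_(l < k) p) :=
  let Dk : 'M[R]_(\sum_(l < k) p, \sum_(l < k) n) :=
    \mxblock_(i < k, j < k) (if i == j then Dmx Psi W i.+1 else 0) in
  let JSigma : 'M[R]_(\sum_(l < k) n, \sum_(l < k) n) :=
    \mxblock_(i < k, j < k) Sigma in
  Dk *m JSigma *m Dk^T.

Definition joint_bias (R : realType) (n p : nat) (Psi : 'M[R]_(p, n))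
    (W : nat -> 'M[R]_n) (fX : 'cV[R]_n) (theta : 'cV[R]_p) (k : nat)
    : 'cV[R]_(\sum_(l < k) p) :=
  \mxcol_(l < k) (thetat Psi W l.+1 fX - theta).

(* Delta(k) *)
Definition modeling_bias (R : realType) (n p : nat) (Psi : 'M[R]_(p, n))
    (W : nat -> 'M[R]_n) (Sigma : 'M[R]_n) (fX : 'cV[R]_n)
    (theta : 'cV[R]_p) (k : nat) : R :=
  qform (invmx (joint_cov Psi W Sigma k)) (joint_bias Psi W fX theta k).

Definition oracle_index (R : realType) (n p K : nat) (Psi : 'M[R]_(p, n))
    (W : nat -> 'M[R]_n) (Sigma : 'M[R]_n) (fX : 'cV[R]_n)
    (theta : 'cV[R]_p) (Delta : R) : nat :=
  (\max_(1 <= k < K.+1 |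
     (modeling_bias Psi W Sigma fX theta k <= Delta)%R) k)%N.

Definition homogeneous_errors (R : realType) (n : nat)
    (sigma0 sigma : 'I_n -> R) : Prop :=
  (exists s0 : R, forall i, sigma0 i = s0) /\
  (exists s : R, forall i, sigma i = s).

Definition varphi (R : realType) (n : nat) (sigma0 sigma : 'I_n -> R)
    (delta : R) : R :=
  if `[< homogeneous_errors sigma0 sigma >] then 1
  else 2 * (1 + delta) / (1 - delta) ^+ 2 - 1.

(* Main.v *)
Require Import Defs.
From HB Require Import structures.
From mathcomp Require Import complex.
From mathcomp Require Import all_boot all_order all_algebra.
From mathcomp Require Import all_classical all_reals all_analysis.
From mathcomp Require Import measurable_realfun.
From mathcomp Require Import ring lra.
Import Order.TTheory GRing.Theory Num.Theory.
Import numFieldNormedType.Exports.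
Local Open Scope classical_set_scope.
Local Open Scope ring_scope.

(** The loss of the adaptive estimator at the oracle scale k0 is split
    according to the selected index khat.  If khat > k0, the pair (k0, khat)
    has passed its test, so the loss is at most z_{k0}; if khat <= k0, the
    adaptive estimator coincides with the one truncated at k0, whose loss L
    is the quantity that the propagation condition controls.  For k0 = 1 this
    truncated loss vanishes.  In general L depends on Y only through the
    estimators of the scales 1, ..., k0 ([loss_ext]), and it does not change
    when Psi^T theta is added to Y ([loss_shift], because D_l Psi^T = I).
    Hence the propagation condition bounds the moment of order r of L also
    when Y has law N(Psi^T theta, Sigma).

    The theorem concerns the moment of order r/2 under N(f, Sigma_0).  Let Z be
    the likelihood ratio of the two joint laws of the first k0 estimators.  By
    the Cauchy-Schwarz inequality
      E_0 L^{r/2} = E (L^{r/2} Z) <= (E L^r)^{1/2} (E Z^2)^{1/2}.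
    The ratio is taken between laws in dimension m = p k0, not between laws of
    Y in dimension n: this is where the exponents p k0 come from, and why
    Delta(k0) is a quadratic form in the joint bias of the estimators.

    To compute E Z^2, let D be the matrix sending Y to the first k0 estimators,
    S = D Sigma D^T and S_0 = D Sigma_0 D^T.  Since S is positive definite, the
    two are diagonalized together: S = M M^T and S_0 = M diag(l) M^T
    ([simultaneous_diagonalization]), and (A3) says that every l_i lies in
    [1 - delta, 1 + delta].  In the coordinates M^{-1} the two laws are
    products, and a one-dimensional Gaussian integral
    ([integral_likelihood_ratio_sqr]) gives
      E Z^2 = prod_i (l_i (2 - l_i))^{-1/2} exp (b_i^2 / (2 - l_i)),
    where b = M^{-1} D (f - Psi^T theta), so that sum_i b_i^2 = Delta(k0).
    Bounding each factor yields the constant of the theorem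
    ([gaussE_change_of_measure]).

    The probabilistic input is that, for U with orthonormal rows, U eps is
    again a standard Gaussian vector ([gaussian_family_orthonormal]); it is
    applied to U = M^{-1} D Sigma^{1/2} and to its analogue for Sigma_0.  Plane
    rotations reduce the rows of U to signed coordinate vectors one entry at a
    time, and a plane rotation preserves the product of two standard normal
    laws by Fubini and two affine substitutions ([normal_rotation]). *)

(** * Densities, image measures and affine substitutions *)

Section density.
Local Open Scope ereal_scope.
Context {d} {T : measurableType d} {R : realType}.
Variables (mu : {measure set T -> \bar R}) (g : T -> R).
Hypotheses (mg : measurable_fun setT g) (g0 : forall x, (0 <= g x)%R).

Definition density_measure (A : set T) : \bar R := \int[mu]_(x in A) (g x)%:E.

Let density0 : density_measure set0 = 0.
Proof. exact: integral_set0. Qed.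

Let density_ge0 A : 0 <= density_measure A.
Proof. by apply: integral_ge0 => x _; rewrite lee_fin. Qed.

Let density_sigma_additive : semi_sigma_additive density_measure.
Proof.
apply: (@semi_sigma_additive_nng_induced _ _ _ mu (EFin \o g)) => [|x].
  exact/measurable_EFinP.
by rewrite lee_fin.
Qed.

HB.instance Definition _ :=
  isMeasure.Build _ _ _ density_measure density0 density_ge0 density_sigma_additive.

(** The same function as a bundled measure, which needs the proofs that [g] is
    measurable and nonnegative as arguments. *)
Definition weighted_measure : {measure set T -> \bar R} := density_measure.

Import HBNNSimple.

(** Both sides agree on indicators of level sets, hence on nonnegative simple
    functions, hence by monotone convergence.  The measure [nu] is a variable
    so that the lemma serves the normal laws as well as [weighted_measure]. *)
Lemma ge0_integral_density (nu : {measure set T -> \bar R}) (f : T -> \bar R) :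
    (forall A, measurable A -> nu A = \int[mu]_(x in A) (g x)%:E) ->
    measurable_fun setT f -> (forall x, 0 <= f x) ->
  \int[nu]_x f x = \int[mu]_x (f x * (g x)%:E).
Proof.
move=> nuE mf f0.
pose f_ := nnsfun_approx measurableT mf.
have fnn n x : 0 <= (f_ n x)%:E by rewrite lee_fin.
have mfn n : measurable_fun setT (fun x => (f_ n x)%:E) by exact/measurable_EFinP.
have mgE : measurable_fun setT (fun x => (g x)%:E) by exact/measurable_EFinP.
have H n : \int[nu]_x (f_ n x)%:E = \int[mu]_x ((f_ n x)%:E * (g x)%:E).
  under [LHS]eq_integral do rewrite fimfunE -fsumEFin//.
  rewrite [LHS]ge0_integral_fsum//; last 2 first.
    - by move=> r; exact/measurable_EFinP/measurableT_comp.
    - by move=> m x _; rewrite EFinM nnfun_muleindic_ge0.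
  under [RHS]eq_integral.
    move=> x xD; rewrite fimfunE -fsumEFin// ge0_mule_fsuml; last first.
      by move=> r; rewrite EFinM nnfun_muleindic_ge0.
    over.
  rewrite [RHS]ge0_integral_fsum//; last 2 first.
    - move=> r; apply: emeasurable_funM => //.
      by apply/measurable_EFinP; exact/measurableT_comp.
    - move=> m x _; apply: mule_ge0; last by rewrite lee_fin.
      by rewrite EFinM nnfun_muleindic_ge0.
  apply: eq_fsbigr => r _.
  have mI : measurable (f_ n @^-1` [set r]) by [].
  rewrite integralZl_indic_nnsfun//= integral_indic// setIT nuE//.
  have [->|r0] := eqVneq r 0%R.
    by rewrite mul0e integral0_eq// => x _; rewrite mul0r mul0e.
  rewrite integral_mkcond.
  have [rneg|rpos] := ltP r 0%R.
    have -> : f_ n @^-1` [set r] = set0.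
      apply/seteqP; split => // x /= fx.
      by have := fnn n x; rewrite fx lee_fin leNgt rneg.
    rewrite patch_set0 integral0 mule0 integral0_eq// => x _.
    by rewrite indicE in_set0 mulr0 mul0e.
  rewrite -ge0_integralZl//.
  - apply: eq_integral => x _; rewrite patchE indicE.
    by case: ifP => _; rewrite ?mulr1 ?mulr0 ?mul0e ?mule0.
  - by apply/measurable_restrict => //; rewrite setTI; apply: measurable_funTS.
  - by move=> x _; rewrite patchE; case: ifP; rewrite ?lee_fin.
transitivity (limn (fun n => \int[nu]_x (f_ n x)%:E)).
  rewrite -monotone_convergence//=.
    by apply: eq_integral => x _; apply/esym/cvg_lim => //; exact: cvg_nnsfun_approx.
  by move=> x _ a b ab; rewrite lee_fin; exact/lefP/nd_nnsfun_approx.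
transitivity (limn (fun n => \int[mu]_x ((f_ n x)%:E * (g x)%:E))).
  by congr (limn _); apply/funext => n.
rewrite -monotone_convergence//=.
- apply: eq_integral => x _; apply/cvg_lim => //.
  by apply: cvgeZr => //; exact: cvg_nnsfun_approx.
- by move=> n; apply: emeasurable_funM.
- by move=> n x _; rewrite mule_ge0 ?lee_fin.
- move=> x _ a b ab; rewrite lee_wpmul2r ?lee_fin//.
  exact/lefP/nd_nnsfun_approx.
Qed.

End density.

Section law.
Context d d' (T1 : measurableType d) (T2 : measurableType d') (R : realType).
Variables (m : {measure set T1 -> \bar R}) (f : T1 -> T2).
Hypothesis mf : measurable_fun [set: T1] f.

(** The image measure, bundled: the measurability proof is an argument so that
    [law m mf] is a measure for the type checker. *)
Definition law : {measure set T2 -> \bar R}.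
Proof. by refine (pushforward m f : {measure set T2 -> \bar R}). Defined.

Lemma lawE A : law A = m (f @^-1` A). Proof. by []. Qed.

Lemma ge0_integral_law (h : T2 -> \bar R) :
    measurable_fun setT h -> (forall y, (0 <= h y)%E) ->
  (\int[law]_y h y = \int[m]_x h (f x))%E.
Proof.
by move=> mh h0; rewrite [LHS]ge0_integral_pushforward//= preimage_setT.
Qed.

End law.
Arguments law {d d' T1 T2 R} m {f} mf.
Arguments ge0_integral_law {d d' T1 T2 R} m {f} mf h.

Section lebesgue_affine.
Local Open Scope ereal_scope.
Context {R : realType}.
Notation leb := (@lebesgue_measure R).

Lemma measurable_affine (b s : R) : measurable_fun setT (fun x : R => (b + s * x)%R).
Proof. by apply: measurable_funD => //; apply: measurable_funM. Qed.

(** The image of [s] times Lebesgue measure under [x |-> b + s x] gives each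
    interval its length, so it is Lebesgue measure. *)
Lemma ge0_integral_affine (b s : R) (f : R -> \bar R) : (0 < s)%R ->
    measurable_fun setT f -> (forall x, 0 <= f x) ->
  \int[leb]_x f x = s%:E * \int[leb]_x f (b + s * x)%R.
Proof.
move=> s0 mf f0.
have maff := measurable_affine b s.
pose phi0 : measurableTypeR R -> measurableTypeR R := fun x => (b + s * x)%R.
have mphi : measurable_fun setT phi0 by exact: maff.
pose m := mscale (NngNum (ltW s0)) (law leb mphi).
have H A : measurable A -> leb A = m A.
  apply: (@lebesgue_measure_unique R m) => // _ [[a c]] _ <-.
  transitivity (s%:E * lebesgue_measure (`]((a - b) / s)%R, ((c - b) / s)%R]%classic : set R)); last first.
    rewrite /m/= /mscale/=; congr (_ * leb _).
    apply/seteqP; split => x /=; rewrite /phi0 !in_itv/=.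
      by rewrite ltr_pdivrMr// ler_pdivlMr// [(x * s)%R]mulrC => /andP[h1 h2]; lra.
    by move=> /andP[h1 h2]; move: h1 h2; rewrite ltr_pdivrMr// ler_pdivlMr// [(x * s)%R]mulrC; lra.
  rewrite (lebesgue_measure_itv `]((a - b) / s)%R, ((c - b) / s)%R]).
  rewrite (lebesgue_measure_itv `]a, c]) /= !lte_fin ltr_pM2r ?invr_gt0// ltrD2r.
  case: ifP => _; last by rewrite mule0.
  by rewrite -!EFinB -EFinM -mulrBl mulrC divfK ?gt_eqF//; congr EFin; ring.
rewrite (eq_measure_integral m); last by move=> A mA _; exact: H.
rewrite ge0_integral_mscale//=; congr (_ * _).
by rewrite (ge0_integral_law _ mphi).
Qed.

End lebesgue_affine.

(** * Rotation invariance of the standard normal law in the plane *)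

Section gaussian_rotation.
Local Open Scope ereal_scope.
Context {R : realType}.
Notation leb := (@lebesgue_measure R).
Notation gamma := (@normal_prob R 0 1).
Notation phi := (@normal_pdf R 0 1).

Lemma ge0_integral_normal (b s : R) (f : R -> \bar R) :
    measurable_fun setT f -> (forall x, 0 <= f x) ->
  \int[normal_prob b s]_x f x = \int[leb]_x (f x * (normal_pdf b s x)%:E).
Proof.
move=> mf f0; apply: ge0_integral_density => //.
  exact: measurable_normal_pdf.
by move=> x; exact: normal_pdf_ge0.
Qed.

Lemma normal_pdf_rotation (c s x y : R) : (c ^+ 2 + s ^+ 2 = 1)%R ->
  (phi (c * x + s * y) * phi (- s * x + c * y) = phi x * phi y)%R.
Proof.
move=> cs; rewrite normal_pdfE ?oner_eq0// /normal_fun !subr0.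
rewrite mulrACA -expRD [RHS]mulrACA -expRD; congr (_ * expR _)%R.
rewrite -!mulrDl; congr (_ / _)%R.
transitivity (- ((c ^+ 2 + s ^+ 2) * (x ^+ 2 + y ^+ 2)))%R; first by ring.
by rewrite cs; ring.
Qed.

Let psi (A : set R) (u : R) : \bar R := (\1_A u * phi u)%:E.

Let psi_ge0 A u : 0 <= psi A u.
Proof. by rewrite lee_fin mulr_ge0 ?normal_pdf_ge0. Qed.

Let mpsi A : measurable A -> measurable_fun setT (psi A).
Proof.
move=> mA; apply/measurable_EFinP; apply: measurable_funM => //.
exact: measurable_normal_pdf.
Qed.

Let int_psi A : measurable A -> \int[leb]_x psi A x = gamma A.
Proof.
move=> mA; rewrite /normal_prob [RHS]integral_mkcond.
apply: eq_integral => x _; rewrite patchE /psi indicE.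
by case: ifP => _; rewrite ?mul1r ?mul0r.
Qed.

Lemma measurable_rotated_box (c s : R) (A B : set R) : measurable A -> measurable B ->
  measurable [set z : R * R | A (c * z.1 + s * z.2)%R /\ B (- s * z.1 + c * z.2)%R].
Proof.
move=> mA mB.
have mlin (p q : R) : measurable_fun setT (fun z : R * R => (p * z.1 + q * z.2)%R).
  by apply: measurable_funD; apply: measurable_funM.
rewrite (_ : mkset _ = (fun z : R * R => (c * z.1 + s * z.2)%R) @^-1` A `&`
  (fun z : R * R => (- s * z.1 + c * z.2)%R) @^-1` B)//.
by apply: measurableI; rewrite -[X in measurable X]setTI; apply: mlin.
Qed.

(** With [psi A = 1_A phi], rotation invariance of the density turns the
    probability of the rotated box into the integral of
    [psi A (c x + s y) psi B (- s x + c y)].  At fixed [x] substitute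
    [v = - s x + c y] for [y], swap the integrals, and at fixed [v] substitute
    [u = (x + s v) / c] for [x]; the factors [1 / c] and [c] cancel and the
    integral splits.  This needs [c > 0]; the sign of the rotated vector is
    treated separately by [normal_probN]. *)
Lemma normal_rotation (c s : R) (A B : set R) : (0 < c)%R ->
    (c ^+ 2 + s ^+ 2 = 1)%R -> measurable A -> measurable B ->
  (gamma \x gamma) [set z | A (c * z.1 + s * z.2)%R /\ B (- s * z.1 + c * z.2)%R]
    = gamma A * gamma B.
Proof.
move=> c0 cs mA mB.
set E := [set z | _].
have mE : measurable E by exact: measurable_rotated_box.
rewrite -(setIT E) -integral_indic// fubini_tonelli1/=; last 2 first.
- exact/measurable_EFinP.
- by move=> x; rewrite lee_fin.
have indE x y : \1_E (x, y) = (\1_A (c * x + s * y) * \1_B (- s * x + c * y))%R :> R.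
  rewrite !indicE -natrM mulnb; congr (_%:R)%R; congr nat_of_bool.
  by apply/idP/andP; rewrite !inE.
have mslice x : measurable_fun setT (fun y => (\1_E (x, y))%:E : \bar R).
  rewrite (_ : (fun y => _) = (fun y =>
      (\1_A (c * x + s * y) * \1_B (- s * x + c * y))%:E)); last first.
    by apply/funext => y; rewrite indE.
  apply/measurable_EFinP; apply: measurable_funM.
    exact: (measurableT_comp (measurable_indic mA) (measurable_affine (c * x) s)).
  exact: (measurableT_comp (measurable_indic mB) (measurable_affine (- s * x) c)).
have c' : (0 < c^-1)%R by rewrite invr_gt0.
pose g (z : R * R) := psi A ((z.1 + s * z.2) / c)%R * psi B z.2.
have mg : measurable_fun setT g.
  apply: emeasurable_funM.
    apply: (measurableT_comp (mpsi A mA)).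
    by apply: measurable_funM => //; apply: measurable_funD => //; apply: measurable_funM.
  exact: (measurableT_comp (mpsi B mB)).
have g0 z : 0 <= g z by apply: mule_ge0; exact: psi_ge0.
have mgx x : measurable_fun setT (fun v => g (x, v)).
  apply: emeasurable_funM; last exact: mpsi.
  apply: (measurableT_comp (mpsi A mA)).
  apply: measurable_funM => //; exact: measurable_affine.
transitivity (\int[leb]_x (c^-1%:E * \int[leb]_v g (x, v))).
  rewrite ge0_integral_normal; last 2 first.
  - apply: measurable_fun_fubini_tonelli_F; first exact/measurable_EFinP.
    by move=> z; rewrite lee_fin.
  - by move=> x; apply: integral_ge0 => y _; rewrite lee_fin.
  apply: eq_integral => x _.
  rewrite /fubini_F ge0_integral_normal//.
  rewrite (ge0_integral_affine (- s * x) c (fun v => g (x, v)) c0 (mgx x))//.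
  rewrite muleA -EFinM mulVf ?gt_eqF// mul1e.
  rewrite -ge0_integralZr//; last 3 first.
  - apply: emeasurable_funM; first exact: mslice.
    by apply/measurable_EFinP; exact: measurable_normal_pdf.
  - by move=> y _; apply: mule_ge0; rewrite lee_fin ?normal_pdf_ge0.
  - by rewrite lee_fin normal_pdf_ge0.
  apply: eq_integral => y _; rewrite /g /psi/= -!EFinM; congr (_%:E).
  have -> : ((x + s * (- s * x + c * y)) / c = c * x + s * y)%R.
    apply: (mulIf (lt0r_neq0 c0)); rewrite divfK ?gt_eqF//.
    transitivity ((1 - s ^+ 2) * x + s * c * y)%R; first by ring.
    by rewrite -cs; ring.
  rewrite indE -mulrA [(phi y * _)%R]mulrC -(normal_pdf_rotation c s x y cs).
  by rewrite mulrACA.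
have fub : \int[leb]_x \int[leb]_v g (x, v) = \int[leb]_v \int[leb]_x g (x, v).
  exact: (@fubini_tonelli _ _ _ _ R leb leb g mg g0).
transitivity (\int[leb]_v (c^-1%:E * \int[leb]_x g (x, v))).
  have mG : measurable_fun setT (fun v => \int[leb]_x g (x, v)) :=
    @measurable_fun_fubini_tonelli_G _ _ _ _ R leb g mg g0.
  have mF : measurable_fun setT (fun x => \int[leb]_v g (x, v)) :=
    @measurable_fun_fubini_tonelli_F _ _ _ _ R leb g mg g0.
  have cc : 0 <= c^-1%:E by rewrite lee_fin ltW.
  have F0 x : (setT : set R) x -> 0 <= \int[leb]_v g (x, v).
    by move=> _; apply: integral_ge0.
  have G0 v : (setT : set R) v -> 0 <= \int[leb]_x g (x, v).
    by move=> _; apply: integral_ge0.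
  transitivity (c^-1%:E * \int[leb]_x \int[leb]_v g (x, v)).
    exact: (ge0_integralZl leb measurableT mF F0 cc).
  by rewrite fub; exact/esym/(ge0_integralZl leb measurableT mG G0 cc).
transitivity (\int[leb]_v (gamma A * psi B v)); last first.
  have gA : 0 <= gamma A by exact: measure_ge0.
  rewrite -(int_psi B mB).
  exact: (ge0_integralZl leb measurableT (mpsi B mB) (fun v _ => psi_ge0 B v) gA).
apply: eq_integral => v _.
rewrite -(int_psi A mA).
rewrite (ge0_integral_affine (s * v / c)%R (c^-1)%R (psi A) c' (mpsi A mA) (psi_ge0 A)) -muleA.
congr (_ * _).
have ma : measurable_fun setT (fun x => psi A (s * v / c + c^-1 * x)%R).
  exact: measurableT_comp (mpsi A mA) (measurable_affine _ _).
rewrite -(ge0_integralZr leb measurableT ma (fun x _ => psi_ge0 A _) (psi_ge0 B v)).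
apply: eq_integral => x _; rewrite /g/=; congr (psi A _ * _).
by rewrite mulrDl addrC [(c^-1 * x)%R]mulrC.
Qed.

Lemma normal_probN (A : set R) : measurable A -> gamma (-%R @^-1` A) = gamma A.
Proof.
move=> mA.
have mN : measurable_fun setT (-%R : measurableTypeR R -> measurableTypeR R).
  exact: oppr_measurable.
rewrite -!int_psi//; last by rewrite -[X in measurable X]setTI; exact: oppr_measurable.
rewrite [RHS](eq_measure_integral (law leb mN)); last first.
  by move=> B mB _; exact/esym/lebesgue_measureN.
rewrite [RHS](ge0_integral_law leb mN (psi A) (mpsi A mA) (psi_ge0 A)).
apply: eq_integral => x _; rewrite /psi !normal_pdfE ?oner_eq0// /normal_fun !subr0.
by rewrite sqrrN !indicE.
Qed.

End gaussian_rotation.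

(** * Families of random variables with a product law *)

Section uniqueness.
Context {R : realType}.

Lemma finite_measure_prod_unique {d1 d2} {T1 : measurableType d1}
    {T2 : measurableType d2} (m1 m2 : {measure set (T1 * T2) -> \bar R}) :
    (m1 setT < +oo)%E ->
    (forall A B, measurable A -> measurable B -> m1 (A `*` B) = m2 (A `*` B)) ->
  forall E, measurable E -> m1 E = m2 E.
Proof.
move=> m1oo m12 E mE.
pose G : set (set (T1 * T2)) := [set A `*` B | A in measurable & B in measurable].
apply: (measure_unique G (fun _ => setT)) => //.
- exact: measurable_prod_measurableType.
- move=> _ _ [A mA [B mB <-]] [A' mA' [B' mB' <-]].
  rewrite -setXI; exists (A `&` A'); first exact: measurableI.
  by exists (B `&` B') => //; exact: measurableI.
- by move=> _; exists setT => //; exists setT => //; rewrite setXTT.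
- by apply/seteqP; split => // x _; exists 0%N.
- by move=> _ [A mA [B mB <-]]; exact: m12.
Qed.

Lemma measurable_box {d} {T : measurableType d} {n} (X : 'I_n -> T -> R)
    (A : 'I_n -> set R) :
    (forall i, measurable_fun setT (X i)) -> (forall i, measurable (A i)) ->
  measurable (\bigcap_i (X i @^-1` A i)).
Proof.
move=> mX mA; apply: fin_bigcap_measurable => [|i _]; first exact: finite_finset.
by rewrite -[X in measurable X]setTI; exact: mX.
Qed.

(** Boxes are stable under intersection and generate the product sigma-algebra
    on tuples, so this is the pi-lambda theorem. *)
Lemma finite_measure_tuple_unique {n} (m1 m2 : {measure set (n.-tuple R) -> \bar R}) :
    (m1 setT < +oo)%E ->
    (forall A : 'I_n -> set R, (forall i, measurable (A i)) ->
      m1 (\bigcap_i ((fun x => tnth x i) @^-1` A i)) =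
      m2 (\bigcap_i ((fun x => tnth x i) @^-1` A i))) ->
  forall E, measurable E -> m1 E = m2 E.
Proof.
move=> m1oo m12 E mE.
pose box (A : 'I_n -> set R) : set (n.-tuple R) :=
  \bigcap_i ((fun x => tnth x i) @^-1` A i).
pose G : set (set (n.-tuple R)) :=
  [set box A | A in [set A | forall i, measurable (A i)]].
apply: (measure_unique G (fun _ => setT)) => //.
- apply/seteqP; split.
    apply: smallest_sub; first exact: smallest_sigma_algebra.
    rewrite -bigcup_seq => B [i /= _ [C mC <-]].
    apply: sub_sigma_algebra; exists (fun j => if j == i then C else setT).
      by move=> j /=; case: ifP.
    rewrite setTI; apply/seteqP; split => x /=.
      by move=> /(_ i Logic.I); rewrite /= eqxx.
    by move=> Cx j _ /=; case: eqVneq => // ->.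
  apply: smallest_sub; first exact: sigma_algebra_measurable.
  move=> _ [A mA <-]; apply: (measurable_box (fun i (x : n.-tuple R) => tnth x i)) => // i.
  exact: measurable_tnth.
- move=> _ _ [A mA <-] [B mB <-]; exists (fun i => A i `&` B i).
    by move=> i; exact: measurableI.
  rewrite /box -bigcapI; apply: eq_bigcapr => i _.
  by rewrite preimage_setI.
- move=> _; exists (fun _ => setT) => //.
  by apply/seteqP; split.
- by apply/seteqP; split => // x _; exists 0%N.
- by move=> _ [A mA <-]; exact: m12.
Qed.

End uniqueness.

Section families.
Context {d} {T : measurableType d} {R : realType}.

(** Mutual independence with prescribed marginals, stated on full boxes only:
    the factors that are to be ignored are taken equal to the whole line.  The
    values being finite, the product is one of real numbers. *)
Definition product_law (P : {measure set T -> \bar R}) {n}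
    (mu : 'I_n -> probability (measurableTypeR R) R) (X : 'I_n -> T -> R) : Prop :=
  (forall i, measurable_fun setT (X i)) /\
  forall A : 'I_n -> set R, (forall i, measurable (A i)) ->
    P (\bigcap_i (X i @^-1` A i)) = (\prod_i fine (mu i (A i)))%:E.

Definition gaussian_family (P : {measure set T -> \bar R}) {n} (X : 'I_n -> T -> R) :=
  product_law P (fun=> normal_prob 0 1) X.

Definition givens {n} (a b : 'I_n) (c s : R) (x : 'I_n -> R) : 'I_n -> R :=
  fun i => if i == a then c * x a + s * x b
           else if i == b then - s * x a + c * x b else x i.

Lemma givens_dot {n} (a b : 'I_n) (c s : R) (x y : 'I_n -> R) : a != b ->
    c ^+ 2 + s ^+ 2 = 1 ->
  \sum_i givens a b c s x i * givens a b c s y i = \sum_i x i * y i.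
Proof.
move=> ab cs; rewrite (bigD1 a)//= (bigD1 b) 1?eq_sym//=.
rewrite [RHS](bigD1 a)//= [in RHS](bigD1 b) 1?eq_sym//= !addrA.
congr (_ + _); last first.
  by apply: eq_bigr => i /andP[/negbTE ia /negbTE ib]; rewrite /givens ia ib.
rewrite /givens !eqxx eq_sym (negbTE ab).
transitivity ((c ^+ 2 + s ^+ 2) * (x a * y a + x b * y b)); first by ring.
by rewrite cs mul1r.
Qed.

(** For fixed conditions on the coordinates other than [a] and [b], the law of
    the pair [(X a, X b)] restricted to them is, by uniqueness on rectangles,
    a multiple of the product of two standard normal laws, and
    [normal_rotation] applies to that pair. *)
Lemma gaussian_family_givens (P : probability T R) {n} (X : 'I_n -> T -> R) (a b : 'I_n) (c s : R) :
    gaussian_family P X -> a != b -> 0 < c -> c ^+ 2 + s ^+ 2 = 1 ->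
  gaussian_family P (fun i t => givens a b c s (X ^~ t) i).
Proof.
move=> [mX PX] ab c0 cs; split.
  move=> i; rewrite /givens; case: eqVneq => _; last case: eqVneq => _ //.
    by apply: measurable_funD; apply: measurable_funM.
  by apply: measurable_funD; apply: measurable_funM.
move=> A mA.
(* [D] keeps the conditions on the coordinates that the rotation does not move. *)
pose A0 i := if (i == a) || (i == b) then setT else A i.
have mA0 i : measurable (A0 i) by rewrite /A0; case: ifP.
pose D := \bigcap_i (X i @^-1` A0 i).
have mD : measurable D by exact: measurable_box.
pose XX : T -> measurableTypeR R * measurableTypeR R := fun t => (X a t, X b t).
have mpair : measurable_fun setT XX by exact: (measurable_fun_pair (mX a) (mX b)).
pose gam : probability (measurableTypeR R) R := normal_prob 0 1.
have fin i : gam (A i) \is a fin_num by apply: fin_num_measure; exact: mA.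
pose q := \prod_(i | (i != a) && (i != b)) fine (gam (A i)).
have q0 : 0 <= q by apply: prodr_ge0 => i _; rewrite fine_ge0.
pose m1 := law (mrestr P mD) mpair.
pose m2 : {measure set (measurableTypeR R * measurableTypeR R) -> \bar R} :=
  mscale (NngNum q0) (gam \x gam)%E.
have m12 E : measurable E -> m1 E = m2 E.
  apply: finite_measure_prod_unique.
    rewrite /m1 lawE /= /mrestr preimage_setT setTI.
    by rewrite (le_lt_trans (probability_le1 P mD)) ?ltry.
  move=> B C mB mC.
  pose A1 i := if i == a then B else if i == b then C else A i.
  have mA1 i : measurable (A1 i).
    by rewrite /A1; case: ifP => _; [exact: mB|case: ifP => _; [exact: mC|exact: mA]].
  transitivity (P (\bigcap_i (X i @^-1` A1 i))).
    rewrite /m1 lawE /= /mrestr; congr (P _); apply/seteqP; split => t /=.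
      move=> [[Bt Ct] Dt] i _ /=; rewrite /A1.
      case: eqVneq => [->//|ia]; case: eqVneq => [->//|ib].
      by have := Dt i Logic.I; rewrite /= /A0 (negbTE ia) (negbTE ib).
    move=> At; split; first split.
    - by have := At a Logic.I; rewrite /= /A1 eqxx.
    - by have := At b Logic.I; rewrite /= /A1 eqxx eq_sym (negbTE ab).
    - move=> i _ /=; rewrite /A0; have := At i Logic.I; rewrite /= /A1.
      by case: eqVneq => // ia; case: eqVneq.
  rewrite PX// /m2/= /mscale/= product_measure1E//.
  rewrite (bigD1 a)//= (bigD1 b) 1?eq_sym//= /A1 eqxx eq_sym (negbTE ab) eqxx.
  rewrite (eq_bigr (fun i => fine (gam (A i)))); last first.
    by move=> i /andP[/negbTE -> /negbTE ->].
  by rewrite -/q mulrA mulrC EFinM EFinM !fineK ?fin_num_measure.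
transitivity (m1 [set z | A a (c * z.1 + s * z.2) /\ A b (- s * z.1 + c * z.2)]).
  rewrite /m1 lawE /= /mrestr; congr (P _); apply/seteqP; split => t /=.
    move=> At; split; first split.
    - by have := At a Logic.I; rewrite /= /givens eqxx.
    - by have := At b Logic.I; rewrite /= /givens eqxx eq_sym (negbTE ab).
    - move=> i _ /=; rewrite /A0; have := At i Logic.I; rewrite /= /givens.
      by case: eqVneq => // ia; case: eqVneq.
  move=> [[Bt Ct] Dt] i _ /=; rewrite /givens.
  case: eqVneq => [->//|ia]; case: eqVneq => [->//|ib].
  by have := Dt i Logic.I; rewrite /= /A0 (negbTE ia) (negbTE ib).
rewrite m12.
  rewrite /m2/= /mscale/= normal_rotation//.
  rewrite [in RHS](bigD1 a)//= [in RHS](bigD1 b) 1?eq_sym//=.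
  rewrite -/q mulrA [RHS]EFinM muleC EFinM.
  by rewrite (fineK (fin a)) (fineK (fin b)).
exact: (measurable_rotated_box c s (A a) (A b) (mA a) (mA b)).
Qed.

End families.

(** * Orthonormal combinations of a standard Gaussian family *)

Section orthonormal.
Context {d} {T : measurableType d} {R : realType} (P : probability T R).

Definition orthonormal_rows {m n} (U : 'I_m -> 'I_n -> R) : Prop :=
  forall i k, \sum_j U i j * U k j = (i == k)%:R.

Definition mix {m n} (U : 'I_m -> 'I_n -> R) (X : 'I_n -> T -> R) (i : 'I_m) (t : T) : R :=
  \sum_j U i j * X j t.

Definition supp {n} (x : 'I_n -> R) : {set 'I_n} := [set j | x j != 0].

Lemma orthonormal_supp_gt0 {m n} (U : 'I_m -> 'I_n -> R) i :
  orthonormal_rows U -> (0 < #|supp (U i)|)%N.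
Proof.
move=> oU; rewrite lt0n cards_eq0; apply/eqP => U0.
have := oU i i; rewrite eqxx big1 => [/eqP|j _]; first by rewrite eq_sym oner_eq0.
by have /finset.setP/(_ j) := U0; rewrite !inE => /negbFE/eqP ->; rewrite mul0r.
Qed.

Lemma measurable_mix {m n} (U : 'I_m -> 'I_n -> R) (X : 'I_n -> T -> R) i :
  (forall j, measurable_fun setT (X j)) -> measurable_fun setT (mix U X i).
Proof.
move=> mX; apply: measurable_sum => j.
by apply: measurable_funM.
Qed.

(** Here every row is plus or minus a coordinate vector, and distinct rows pick
    distinct coordinates; the sign is harmless by [normal_probN]. *)
Lemma gaussian_family_monomial {m n} (U : 'I_m -> 'I_n -> R) (X : 'I_n -> T -> R) :
    orthonormal_rows U -> (forall i, #|supp (U i)| <= 1)%N ->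
  gaussian_family P X -> gaussian_family P (mix U X).
Proof.
move=> oU mono [mX PX]; split; first by move=> i; exact: measurable_mix.
have /(_ _)/cards1P supp1 i : #|supp (U i)| == 1%N.
  by rewrite eqn_leq mono orthonormal_supp_gt0.
have /choice[pi piP] i : exists j, supp (U i) = [set j]%SET by exact: supp1.
have U0 i j : j != pi i -> U i j = 0.
  by have /finset.setP/(_ j) := piP i; rewrite !inE => /eqP; case: (U i j =P 0) => // _; case: eqP.
have sumU i (y : 'I_n -> R) : \sum_j U i j * y j = U i (pi i) * y (pi i).
  by rewrite (bigD1 (pi i))//= big1 ?addr0// => j /U0 ->; rewrite mul0r.
have U1 i : U i (pi i) * U i (pi i) = 1 by rewrite -sumU oU eqxx.
have pi_inj : injective pi.
  move=> i k ik; apply/eqP; have := oU i k; rewrite sumU ik.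
  case: eqVneq => // ink /eqP; rewrite mulf_eq0 => /orP[] /eqP U0'.
    by have := U1 i; rewrite ik U0' mul0r => /eqP; rewrite eq_sym oner_eq0.
  by have := U1 k; rewrite U0' mul0r => /eqP; rewrite eq_sym oner_eq0.
have Upm i : U i (pi i) = 1 \/ U i (pi i) = -1.
  by have /eqP := U1 i; rewrite -expr2 sqrf_eq1 => /orP[] /eqP ->; [left|right].
move=> A mA.
pose gam : probability (measurableTypeR R) R := normal_prob 0 1.
pose B i := (fun x => U i (pi i) * x) @^-1` A i.
have mB i : measurable (B i).
  by rewrite -[X in measurable X]setTI; apply: measurable_funM.
have gB i : gam (B i) = gam (A i).
  rewrite /B; case: (Upm i) => ->.
    by congr (gam _); apply/seteqP; split => x /=; rewrite mul1r.
  rewrite -[RHS](normal_probN _ (mA i)).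
  by congr (gam _); apply/seteqP; split => x /=; rewrite mulN1r.
pose C j := \bigcap_(i in [set i | pi i = j]) B i.
have CE i : C (pi i) = B i.
  apply/seteqP; split => [x /(_ i erefl)//|x Bx k /= /pi_inj ->//].
have mC j : measurable (C j).
  apply: fin_bigcap_measurable => // ; exact: finite_finset.
transitivity (P (\bigcap_i (X i @^-1` C i))).
  congr (P _); apply/seteqP; split => t /= H.
    by move=> j _ i /= <-; have := H i Logic.I; rewrite /= /mix sumU.
  by move=> i _; have := H (pi i) Logic.I; rewrite /= CE /mix sumU.
rewrite PX//; congr EFin.
rewrite (bigID (fun j => j \in pi @: [set: 'I_m]%SET))/= [X in _ * X]big1 ?mulr1.
  rewrite big_imset/=; last by move=> x y _ _; exact: pi_inj.
  by apply: eq_big => i; rewrite ?inE// CE => _; congr fine; exact: gB.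
move=> j jpi; have -> : C j = setT.
  apply/seteqP; split => // x _ i /= ij.
  by move: jpi; rewrite -ij imset_f ?inE.
by have -> : normal_prob 0 1 setT = 1%E :> \bar R by exact: (@probability_setT _ _ _ gam).
Qed.

(** A plane rotation of the columns [a] and [b] of [U], matched by the same
    rotation of [X], leaves [mix U X] unchanged ([givens_dot]).  Applied to two
    nonzero entries of a row [k] it kills one of them.  A row that already has
    a single nonzero entry is orthogonal to row [k], so it vanishes at [a] and
    [b] and is not disturbed.  The induction is on the number of rows with
    several nonzero entries, then on the number of nonzero entries of row
    [k]. *)
Lemma gaussian_family_orthonormal {m n} (U : 'I_m -> 'I_n -> R) (X : 'I_n -> T -> R) :
    orthonormal_rows U ->
  gaussian_family P X -> gaussian_family P (mix U X).
Proof.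
pose bad (U : 'I_m -> 'I_n -> R) := [set i | (1 < #|supp (U i)|)%N]%SET.
have [N] := ubnP #|bad U|; elim: N => // N IHN in U X *.
rewrite ltnS => badU oU gX.
have [bad0|[k kbad]] := set_0Vmem (bad U).
  apply: gaussian_family_monomial => // i.
  by have /finset.setP/(_ i) := bad0; rewrite !inE ltnNge => /negbFE.
have {kbad}badU : (#|bad U :\ k| < N)%N.
  by move: badU; rewrite (cardsD1 k) kbad.
have [s] := ubnP #|supp (U k)|; elim: s => // s IHs in U X oU gX badU *.
rewrite ltnS => suppU.
have [kU|] := leqP #|supp (U k)| 1.
  apply: IHN => //; rewrite (leq_ltn_trans _ badU)//.
  apply: subset_leq_card; apply/fintype.subsetP => i ibad.
  rewrite in_setD1 ibad andbT; apply/eqP => ik.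
  by move: ibad; rewrite ik inE ltnNge kU.
case/card_gt1P => a [b] []; rewrite !inE => Ua Ub ab.
pose rho := Num.sqrt (U k a ^+ 2 + U k b ^+ 2).
have rho2 : rho ^+ 2 = U k a ^+ 2 + U k b ^+ 2.
  by rewrite sqr_sqrtr// addr_ge0 ?sqr_ge0.
have rho0 : 0 < rho.
  by rewrite sqrtr_gt0 ltr_wpDr ?sqr_ge0// exprn_even_gt0.
(* The rotation that kills the entry [U k b]; the sign of [U k a] is moved to
   the sine so that the cosine is positive. *)
pose c := `|U k a| / rho; pose sn := Num.sg (U k a) * U k b / rho.
have c0 : 0 < c by rewrite divr_gt0 ?normr_gt0.
have cs : c ^+ 2 + sn ^+ 2 = 1.
  rewrite /c /sn !exprMn sqr_sg Ua mul1r real_normK ?num_real// -mulrDl.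
  by rewrite exprVn rho2 divff// -rho2 expf_eq0/= gt_eqF.
pose V i := givens a b c sn (U i).
have Vb : V k b = 0.
  rewrite /V /givens eqxx eq_sym (negbTE ab) /c /sn.
  by rewrite normrEsg; ring.
pose Y := fun i t => givens a b c sn (X ^~ t) i.
have -> : mix U X = mix V Y.
  by apply/funext => i; apply/funext => t; rewrite /mix /V /Y givens_dot.
have monoab i : i \notin bad U -> i != k -> U i a = 0 /\ U i b = 0.
  rewrite inE -leqNgt => Ui1 ik.
  have /cards1P[j Uj] : #|supp (U i)| == 1%N.
    by rewrite eqn_leq Ui1 orthonormal_supp_gt0.
  have U0 l : l != j -> U i l = 0.
    by have /finset.setP/(_ l) := Uj; rewrite !inE => /eqP; case: (U i l =P 0) => // _; case: eqP.
  have Uij : U i j != 0 by have := set11 j; rewrite -Uj inE.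
  have Ukj : U k j = 0.
    have := oU i k; rewrite (negbTE ik) (bigD1 j)//= big1 ?addr0 => [|l /U0 ->]; last by rewrite mul0r.
    by move/eqP; rewrite mulf_eq0 (negbTE Uij) => /eqP.
  by split; apply: U0; apply/eqP => e; [move: Ua|move: Ub]; rewrite e Ukj eqxx.
apply: IHs.
- by move=> i l; rewrite /V givens_dot.
- exact: gaussian_family_givens.
- rewrite (leq_ltn_trans _ badU)//.
  apply: subset_leq_card; apply/fintype.subsetP => i; rewrite !in_setD1 => /andP[ik iV].
  rewrite ik /=; apply/negPn/negP => iU; have [Uia Uib] := monoab i iU ik.
  move/negP: iU; apply; rewrite inE; move: iV; rewrite inE.
  suff -> : supp (V i) = supp (U i) by [].
  apply/setP => j; rewrite !inE /V /givens Uia Uib !mulr0 addr0.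
  by case: (j =P a) => [->|_]; [rewrite Uia|case: (j =P b) => [->|_//]; rewrite Uib].
- rewrite (leq_trans _ suppU)// proper_card//; apply/fintype.properP; split.
    apply/fintype.subsetP => j; rewrite !inE /V /givens.
    case: (j =P a) => [->|_]; first by rewrite Ua.
    by case: (j =P b) => [->|//]; rewrite Ub.
  by exists b; rewrite inE // Vb eqxx.
Qed.

End orthonormal.

(** * Expectations and densities for product laws *)

Section product_expectation.
Context {d} {T : measurableType d} {R : realType} (P : probability T R).

(** True on boxes when every [f i] is an indicator.  One index [j] at a time, an
    indicator is replaced by a general function: as a function of the set [B],
    the integral with [\1_B] at [j] is a measure, equal to a multiple of
    [mu j], and one integrates [f j] against it.  The induction is on the set
    [S] of indices whose function need not be an indicator. *)
Lemma integral_prod_family {n} (mu : 'I_n -> probability (measurableTypeR R) R)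
    (X : 'I_n -> T -> R) (f : 'I_n -> R -> R) (e : 'I_n -> R) :
    product_law P mu X ->
    (forall i, measurable_fun setT (f i)) -> (forall i x, 0 <= f i x) ->
    (forall i, \int[mu i]_x (f i x)%:E = (e i)%:E)%E ->
  (\int[P]_t (\prod_i f i (X i t))%:E = (\prod_i e i)%:E)%E.
Proof.
move=> [mX PX].
have [S fS] : exists S : {set 'I_n},
    forall i, i \notin S -> exists2 A : set R, measurable A & f i = \1_A.
  by exists [set: 'I_n]%SET => i; rewrite inE.
have [N] := ubnP #|S|; elim: N => // N IHN in f e S fS *.
rewrite ltnS => SN mf f0 fe.
have [S0|[j jS]] := set_0Vmem S.
  have /choice[A fA] i : exists A : set R, measurable A /\ f i = \1_A.
    by have [|A mA ->] := fS i; [rewrite S0 inE|exists A].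
  have mA i := (fA i).1.
  have -> : (\prod_i e i)%:E = P (\bigcap_i (X i @^-1` A i)).
    rewrite PX//; congr EFin; apply: eq_bigr => i _.
    have := fe i; rewrite (fA i).2 integral_indic//; last exact: mA.
    by rewrite setIT => ->.
  rewrite -(setIT (\bigcap_i _)) -integral_indic//; last exact: measurable_box.
  apply: eq_integral => t _; congr EFin.
  rewrite indicE; have [Xt|Xt] := boolP (t \in _).
    rewrite big1// => i _; rewrite (fA i).2 indicE mem_set//.
    by move: Xt; rewrite inE => /(_ i Logic.I).
  apply/eqP; rewrite prodf_seq_eq0; apply: contraNT Xt => /hasPn Xt.
  rewrite inE => i _ /=; have := Xt i (mem_index_enum _).
  by rewrite /= (fA i).2 indicE; case: (boolP (_ \in _)); rewrite ?eqxx// inE.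
pose h t := \prod_(i | i != j) f i (X i t).
have mh : measurable_fun setT h.
  rewrite /h; under eq_fun do rewrite -big_filter.
  by apply: measurable_prod => i _; exact: measurableT_comp (mf i) (mX i).
have h0 t : 0 <= h t by apply: prodr_ge0.
pose q := \prod_(i | i != j) e i.
have e0 i : 0 <= e i by rewrite -lee_fin -fe; apply: integral_ge0 => x _; rewrite lee_fin.
have q0 : 0 <= q by exact: prodr_ge0.
pose dens := weighted_measure P h mh h0.
have mXj : measurable_fun setT (X j : T -> measurableTypeR R) by exact: mX.
pose nu := law dens mXj.
have nuE B : measurable B -> nu B = mscale (NngNum q0) (mu j) B.
  move=> mB; rewrite /nu lawE /= /mscale/= /density_measure.
  pose f' i := if i == j then \1_B else f i.
  pose e' i := if i == j then fine (mu j B) else e i.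
  transitivity (\int[P]_t (\prod_i f' i (X i t))%:E)%E.
    rewrite integral_mkcond; apply: eq_integral => t _.
    rewrite (bigD1 j)//= /f' eqxx patchE indicE.
    rewrite (eq_bigr (fun i => f i (X i t))); last by move=> i /negbTE ->.
    rewrite -/(h t) (_ : (t \in X j @^-1` B) = (X j t \in B)); last first.
      by apply/idP/idP; rewrite !inE.
    by case: (X j t \in B); rewrite ?mul1r ?mul0r.
  rewrite (IHN f' e' (S :\ j)%SET).
  - rewrite (bigD1 j)//= /e' eqxx EFinM fineK ?fin_num_measure// muleC.
    by congr (_%:E * _)%E; apply: eq_bigr => i /negbTE ->.
  - move=> i; rewrite !inE negb_and negbK /f' => /orP[/eqP ->|/fS].
      by rewrite eqxx; exists B.
    by case: eqVneq => // _ _; exists B.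
  - by rewrite (leq_trans _ SN)// [leqRHS](cardsD1 j) jS.
  - by move=> i; rewrite /f'; case: ifP.
  - by move=> i x; rewrite /f'; case: ifP.
  - move=> i; rewrite /f' /e'; case: eqVneq => [->|_]; last exact: fe.
    by rewrite integral_indic// setIT fineK ?fin_num_measure.
have mfj : measurable_fun setT (fun x : measurableTypeR R => (f j x)%:E).
  by apply/measurable_EFinP; exact: mf.
transitivity (\int[nu]_x (f j x)%:E)%E.
  rewrite ge0_integral_law//; last by move=> x; rewrite lee_fin.
  rewrite (ge0_integral_density P h mh h0 dens)//; last 2 first.
  - exact: measurableT_comp mfj mXj.
  - by move=> x; rewrite lee_fin.
  by apply: eq_integral => t _; rewrite (bigD1 j)//= -EFinM.
rewrite (eq_measure_integral (mscale (NngNum q0) (mu j))); last by move=> B mB _; exact: nuE.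
rewrite ge0_integral_mscale//=; last by move=> x _; rewrite lee_fin.
by rewrite fe -EFinM mulrC [in RHS](bigD1 j).
Qed.

(** Tuples carry the product sigma-algebra, which column vectors do not. *)
Definition tuple_of_family {n} (X : 'I_n -> T -> R) (t : T) : n.-tuple R :=
  [tuple X i t | i < n].

Lemma measurable_tuple_of_family {n} (X : 'I_n -> T -> R) :
  (forall i, measurable_fun setT (X i)) -> measurable_fun setT (tuple_of_family X).
Proof.
move=> mX; apply/measurable_fun_tnthP => i.
by rewrite (_ : _ \o _ = X i)//; apply/funext => t; rewrite /= tnth_mktuple.
Qed.

(** Taking the image of [P] under [Y], and the image under [X] of [P] weighted
    by the product of the densities, gives two measures that agree on boxes by
    [integral_prod_family]. *)
Lemma integral_product_density {n}
    (mu nu : 'I_n -> probability (measurableTypeR R) R)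
    (rho : 'I_n -> R -> R) (X Y : 'I_n -> T -> R) (h : n.-tuple R -> \bar R) :
    (forall i, measurable_fun setT (rho i)) -> (forall i x, 0 <= rho i x) ->
    (forall i A, measurable A -> nu i A = \int[mu i]_(x in A) (rho i x)%:E)%E ->
    product_law P mu X -> product_law P nu Y ->
    measurable_fun setT h -> (forall x, 0 <= h x)%E ->
  (\int[P]_t h (tuple_of_family Y t) =
   \int[P]_t (h (tuple_of_family X t) * (\prod_i rho i (X i t))%:E))%E.
Proof.
move=> mrho rho0 nurho lX lY mh h0; have [mX PX] := lX; have [mY PY] := lY.
have mtX := measurable_tuple_of_family X mX.
have mtY := measurable_tuple_of_family Y mY.
pose Z t := \prod_i rho i (X i t).
have mZ : measurable_fun setT Z.
  by apply: measurable_prod => i _; exact: measurableT_comp (mrho i) (mX i).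
have Z0 t : 0 <= Z t by apply: prodr_ge0.
pose dens := weighted_measure P Z mZ Z0.
rewrite -(ge0_integral_law P mtY)//.
transitivity (\int[law dens mtX]_x h x)%E; last first.
  rewrite ge0_integral_law// (ge0_integral_density P Z mZ Z0 dens)//.
  exact: measurableT_comp mh mtX.
apply: eq_measure_integral => B mB _; apply: finite_measure_tuple_unique => //.
  by rewrite lawE preimage_setT [ltLHS](probability_setT P) ltry.
move=> A mA.
have boxE (W : 'I_n -> T -> R) : tuple_of_family W @^-1`
     (\bigcap_i ((fun x => tnth x i) @^-1` A i)) = \bigcap_i (W i @^-1` A i).
  by rewrite preimage_bigcap; apply: eq_bigcapr => i _;
    apply/seteqP; split => t /=; rewrite tnth_mktuple.
rewrite !lawE !boxE PY//= /density_measure.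
pose f i x := \1_(A i) x * rho i x.
transitivity (\int[P]_t (\prod_i f i (X i t))%:E)%E.
  apply/esym; apply: (integral_prod_family mu) => //.
  - by move=> i; apply: measurable_funM.
  - by move=> i x; rewrite mulr_ge0.
  - move=> i; have nf : nu i (A i) \is a fin_num by apply: fin_num_measure; exact: mA.
    rewrite (fineK nf) (nurho i (A i) (mA i)).
    rewrite [RHS]integral_mkcond; apply: eq_integral => x _.
    by rewrite patchE /f indicE; case: ifP; rewrite ?mul1r ?mul0r.
rewrite [RHS]integral_mkcond; apply: eq_integral => t _.
rewrite patchE /f big_split/= -/(Z t); case: ifPn => [|].
  rewrite inE => At; rewrite big1 ?mul1r// => i _.
  by rewrite indicE mem_set//; have := At i Logic.I.
move=> tA; suff -> : \prod_i (\1_(A i) (X i t) : R) = 0 by rewrite mul0r.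
apply/eqP; rewrite prodf_seq_eq0; apply: contraNT tA => /hasPn At.
rewrite inE => i _ /=; have := At i (mem_index_enum _).
by rewrite /= indicE; case: (boolP (_ \in _)); rewrite ?eqxx// inE.
Qed.

End product_expectation.

(** * Likelihood ratios of normal laws *)

Section normal_likelihood.
Local Open Scope ereal_scope.
Context {R : realType}.
Notation leb := (@lebesgue_measure R).
Notation gamma := (@normal_prob R 0 1).
Notation phi := (@normal_pdf R 0 1).

Lemma normal_peakE (s : R) : (0 < s)%R ->
  normal_peak s = (s * Num.sqrt (pi *+ 2))^-1%R.
Proof.
move=> s0; rewrite /normal_peak -mulrnAr sqrtrM ?sqr_ge0//.
by rewrite sqrtr_sqr gtr0_norm.
Qed.

Lemma normal_pdf_gt0 (b s x : R) : (0 < s)%R -> (0 < normal_pdf b s x)%R.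
Proof.
by move=> s0; rewrite normal_pdfE ?gt_eqF// mulr_gt0 ?expR_gt0 ?normal_peak_gt0 ?gt_eqF.
Qed.

Definition likelihood_ratio (b s x : R) : R := (normal_pdf b s x / phi x)%R.

Lemma likelihood_ratio_ge0 (b s x : R) : (0 <= likelihood_ratio b s x)%R.
Proof. by rewrite divr_ge0 ?normal_pdf_ge0. Qed.

Lemma measurable_likelihood_ratio (b s : R) :
  measurable_fun setT (likelihood_ratio b s).
Proof.
apply: measurable_funM; first exact: measurable_normal_pdf.
have -> : (fun x => (phi x)^-1%R) =
    (fun x => Num.sqrt (pi *+ 2) * expR (x ^+ 2 / 2))%R.
  apply/funext => x; rewrite normal_pdfE ?oner_eq0// normal_peakE// mul1r.
  rewrite invfM invrK /normal_fun -expRN subr0; congr (_ * expR _)%R.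
  by rewrite expr1n; lra.
apply: measurable_funM => //; apply: measurableT_comp => //.
by apply: measurable_funM => //; exact: measurable_funX.
Qed.

Lemma normal_prob_density (b s : R) (A : set R) : measurable A ->
  normal_prob b s A = \int[gamma]_(x in A) (likelihood_ratio b s x)%:E.
Proof.
move=> mA; rewrite integral_mkcond ge0_integral_normal.
- rewrite /normal_prob integral_mkcond; apply: eq_integral => x _.
  rewrite !patchE; case: ifP => _; rewrite ?mul0e// -EFinM divfK//.
  by rewrite gt_eqF// normal_pdf_gt0.
- apply/measurable_restrict => //; rewrite setTI; apply: measurable_funTS.
  by apply/measurable_EFinP; exact: measurable_likelihood_ratio.
- by move=> x; rewrite patchE; case: ifP => //; rewrite lee_fin likelihood_ratio_ge0.
Qed.

(** Completing the square in the exponent of [N(b, s^2)^2 / N(0, 1)], with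
    [t^2 = 2 - s^2]. *)
Lemma normal_exponent_identity (x b s t : R) :
    (s != 0 -> t != 0 -> s ^+ 2 + t ^+ 2 = 2 ->
  - (x - b) ^+ 2 / (s ^+ 2 *+ 2) + - (x - b) ^+ 2 / (s ^+ 2 *+ 2)
    + - (- (x - 0) ^+ 2 / (1 ^+ 2 *+ 2)) =
  b ^+ 2 / t ^+ 2 + - (x - 2 * b / t ^+ 2) ^+ 2 / ((s / t) ^+ 2 *+ 2))%R.
Proof.
move=> s0 t0; rewrite (expr_div_n s t 2).
rewrite -(mulr_natr (s ^+ 2)%R 2) -(mulr_natr (1 ^+ 2)%R 2) -(mulr_natr (s ^+ 2 / t ^+ 2)%R 2).
have : (s ^+ 2 != 0)%R by rewrite expf_eq0.
have : (t ^+ 2 != 0)%R by rewrite expf_eq0.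
move: (s ^+ 2)%R (t ^+ 2)%R => a c c0 a0 ac.
have ca : (c = 2 - a)%R by rewrite -ac; ring.
have hp : (c * c^-1 = 1)%R by rewrite divff.
have hq : (a * a^-1 = 1)%R by rewrite divff.
rewrite expr1n mul1r subr0 !invfM invrK.
set p := (c^-1)%R in hp *; set q := (a^-1)%R in hq *.
set r := (2^-1)%R.
apply/eqP; rewrite -subr_eq0; apply/eqP.
(* The difference of the two sides lies in the ideal of the relations
   [a q = 1] and [c p = 1]; these are its coordinates. *)
transitivity ((a * q - 1) * (- x ^+ 2 * r + b ^+ 2 * p) +
   (c * p - 1) * (- 2 * b * x * q + 2 * b ^+ 2 * p * q + b ^+ 2 * q)
   )%R; last by rewrite hp hq !subrr !mul0r addr0.
by rewrite ca /r; field.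
Qed.

(** The squared ratio times the standard density is a constant multiple of the
    density of [N(2 b / t^2, (s / t)^2)]; the variance [s^2] must be below [2]
    for the integral to be finite, which is the role of [t]. *)
Lemma integral_likelihood_ratio_sqr (b s t : R) : (0 < s)%R -> (0 < t)%R ->
    (s ^+ 2 + t ^+ 2 = 2)%R ->
  \int[gamma]_x (likelihood_ratio b s x ^+ 2)%:E =
  ((s * t)^-1 * expR (b ^+ 2 / t ^+ 2))%:E.
Proof.
move=> s0 t0 st.
have k0 : (0 < Num.sqrt (pi *+ 2) :> R)%R by rewrite sqrtr_gt0 mulrn_wgt0 ?pi_gt0.
have s0' := lt0r_neq0 s0; have t0' := lt0r_neq0 t0; have k0' := lt0r_neq0 k0.
pose e : R := ((s * t)^-1 * expR (b ^+ 2 / t ^+ 2))%R.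
pose m' : R := (2 * b / t ^+ 2)%R.
have H x : (likelihood_ratio b s x ^+ 2 * phi x = e * normal_pdf m' (s / t) x)%R.
  rewrite /likelihood_ratio !normal_pdfE ?oner_eq0 ?mulf_neq0 ?invr_eq0//.
  rewrite !normal_peakE ?divr_gt0// /e /normal_fun !mul1r.
  set k := Num.sqrt _ in k0 k0' *.
  set E1 := expR (- (x - b) ^+ 2 / _); set E2 := expR (- (x - 0) ^+ 2 / _).
  set E3 := expR (b ^+ 2 / _); set E4 := expR (- (x - m') ^+ 2 / _).
  have E20 : E2 != 0%R by rewrite gt_eqF// expR_gt0.
  have E1234 : (E1 * E1 / E2 = E3 * E4)%R.
    rewrite -expRN -!expRD; congr (expR _)%R; rewrite /m'.
    exact: normal_exponent_identity.
  clearbody k E1 E2 E3 E4.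
  transitivity ((s ^+ 2 * k)^-1 * (E1 * E1 / E2))%R.
    by field; rewrite s0' k0' E20.
  by rewrite E1234; field; rewrite s0' k0' t0'.
rewrite ge0_integral_normal; last 2 first.
- apply/measurable_EFinP; apply: measurable_funX; exact: measurable_likelihood_ratio.
- by move=> x; rewrite lee_fin sqr_ge0.
under eq_integral do rewrite -EFinM H EFinM.
rewrite ge0_integralZl//.
- by rewrite integral_normal_pdf mule1.
- by apply/measurable_EFinP; exact: measurable_normal_pdf.
- by move=> x _; rewrite lee_fin normal_pdf_ge0.
- by rewrite lee_fin mulr_ge0 ?expR_ge0// invr_ge0 mulr_ge0 ?ltW.
Qed.

Lemma normal_fun_affine (b s x : R) : (s != 0)%R ->
  normal_fun b s (b + s * x)%R = normal_fun 0 1 x.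
Proof.
move=> s0; rewrite /normal_fun subr0; congr expR.
rewrite (_ : b + s * x - b = s * x)%R; last by ring.
rewrite (exprMn 2 s x) -(mulr_natr (s ^+ 2)%R 2) -(mulr_natr (1 ^+ 2)%R 2) expr1n.
have : (s ^+ 2 != 0)%R by rewrite expf_eq0.
by move: (s ^+ 2)%R (x ^+ 2)%R => a c a0; field.
Qed.

Lemma normal_prob_affine (b s : R) (A : set R) : (0 < s)%R -> measurable A ->
  gamma ((fun x => b + s * x)%R @^-1` A) = normal_prob b s A.
Proof.
move=> s0 mA.
rewrite /normal_prob [LHS]integral_mkcond [RHS]integral_mkcond.
pose F (y : R) : R := (\1_A y * normal_pdf b s y)%R.
have mF : measurable_fun setT (EFin \o F).
  apply/measurable_EFinP; apply: measurable_funM => //.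
  exact: measurable_normal_pdf.
have F0 y : 0 <= (EFin \o F) y by rewrite lee_fin mulr_ge0 ?normal_pdf_ge0.
transitivity (\int[leb]_y (EFin \o F) y); last first.
  by apply: eq_integral => y _; rewrite patchE /F/= indicE; case: ifP; rewrite ?mul1r ?mul0r.
rewrite (ge0_integral_affine b s _ s0 mF F0).
have s0' : 0 <= s%:E by rewrite lee_fin ltW.
have mFa : measurable_fun setT (fun x => (EFin \o F) (b + s * x)%R).
  exact: (measurableT_comp mF (measurable_affine b s)).
rewrite -(ge0_integralZl leb measurableT mFa (fun x _ => F0 _) s0').
apply: eq_integral => x _; rewrite patchE /F/= indicE.
rewrite (_ : (x \in (fun x => b + s * x)%R @^-1` A) = (b + s * x \in A)%R); last first.
  by apply/idP/idP; rewrite !inE.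
case: ifP => _; last by rewrite mul0r mule0.
rewrite mul1r -EFinM !normal_pdfE ?oner_eq0 ?gt_eqF// !normal_peakE// !mul1r; congr EFin.
have k0 : (0 < Num.sqrt (pi *+ 2) :> R)%R by rewrite sqrtr_gt0 mulrn_wgt0 ?pi_gt0.
by rewrite normal_fun_affine ?gt_eqF// mulrA invfM mulrA divff ?gt_eqF// mul1r.
Qed.

End normal_likelihood.

Lemma measurable_fun_powR d (T : measurableType d) (R : realType) (f : T -> R) (q : R) :
  measurable_fun setT f -> measurable_fun setT (fun x => f x `^ q).
Proof. by move=> mf; exact: measurableT_comp (measurable_powR q) mf. Qed.

(** * The Cauchy-Schwarz bound *)

Section cauchy_schwarz.
Local Open Scope ereal_scope.
Context {d} {T : measurableType d} {R : realType} (mu : {measure set T -> \bar R}).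

(** The inequality in the form used below: finite bounds for the two second
    moments in, a finite bound out. *)
Lemma integral_sqrtM_le (f g : T -> R) (a b : R) :
    measurable_fun setT f -> (forall x, (0 <= f x)%R) ->
    measurable_fun setT g -> (forall x, (0 <= g x)%R) ->
    \int[mu]_x (f x)%:E <= a%:E -> \int[mu]_x (g x ^+ 2)%:E <= b%:E ->
  \int[mu]_x (f x `^ (1 / 2) * g x)%:E <= (a `^ (1 / 2) * b `^ (1 / 2))%:E.
Proof.
move=> mf f0 mg g0 fa gb.
have two0 : (0 < 2 :> R)%R by [].
pose sf x : R := (f x `^ (1 / 2))%R.
have msf : measurable_fun setT sf by exact: measurable_fun_powR.
have := @hoelder _ _ _ mu sf g 2 2 msf mg two0 two0.
rewrite (_ : (2^-1 + 2^-1)%R = 1%R); last by field.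
move=> /(_ erefl); rewrite Lnorm1.
rewrite (eq_integral (fun x => (f x `^ (1 / 2) * g x)%:E)); last first.
  by move=> x _; rewrite gee0_abs// lee_fin mulr_ge0 ?powR_ge0.
move=> /le_trans; apply.
have step (h : T -> R) (c : R) : measurable_fun setT h ->
    \int[mu]_x (h x ^+ 2)%:E <= c%:E -> 'N[mu]_2%:E[EFin \o h] <= (c `^ (1 / 2))%:E.
  move=> mh hc; rewrite unlock /=.
  under eq_integral => x _.
    rewrite powR_mulrn ?normr_ge0// real_normK ?num_real//.
    over.
  have h2 : 0 <= \int[mu]_x (h x ^+ 2)%:E.
    by apply: integral_ge0 => x _; rewrite lee_fin sqr_ge0.
  rewrite -poweR_EFin mul1r; apply: gt0_ler_poweR => //.
    by rewrite in_itv/= leey andbT.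
  by rewrite in_itv/= leey andbT (le_trans h2).
rewrite EFinM; apply: lee_pmul; rewrite ?Lnorm_ge0//; apply: step => //.
apply: le_trans fa; rewrite le_eqVlt; apply/orP; left; apply/eqP.
apply: eq_integral => x _; rewrite /sf -powR_mulrn ?powR_ge0// -powRrM.
by rewrite mul1r mulVf// powRr1.
Qed.

End cauchy_schwarz.

Section gaussian_change.
Context {d} {T : measurableType d} {R : realType} (P : probability T R).

Lemma gaussian_family_affine {n} (X : 'I_n -> T -> R) (b s : 'I_n -> R) :
    (forall i, 0 < s i) -> gaussian_family P X ->
  product_law P (fun i => normal_prob (b i) (s i)) (fun i t => b i + s i * X i t).
Proof.
move=> s0 [mX PX]; split.
  by move=> i; apply: measurable_funD => //; apply: measurable_funM.
move=> A mA.
have mB i : measurable ((fun x => b i + s i * x) @^-1` A i).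
  by rewrite -[X in measurable X]setTI; apply: measurable_affine.
transitivity (P (\bigcap_i (X i @^-1` ((fun x => b i + s i * x) @^-1` A i)))); first by [].
apply: (etrans (PX _ mB)); congr EFin; apply: eq_bigr => i _; congr fine.
exact: (normal_prob_affine (b i) (s i) (A i) (s0 i) (mA i)).
Qed.

(** The law of [b + s X'] has density [Z], the product of the one-dimensional
    likelihood ratios, with respect to the law of [X]; Cauchy-Schwarz then
    separates [h] from [Z], and the second moment of [Z] factorizes. *)
Lemma gaussian_sqrt_change {n} (X X' : 'I_n -> T -> R) (b s t : 'I_n -> R)
    (h : n.-tuple R -> R) (a : R) :
    (forall i, 0 < s i) -> (forall i, 0 < t i) -> (forall i, s i ^+ 2 + t i ^+ 2 = 2) ->
    gaussian_family P X -> gaussian_family P X' ->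
    measurable_fun setT h -> (forall x, 0 <= h x) ->
    (\int[P]_w (h (tuple_of_family X w))%:E <= a%:E)%E ->
  (\int[P]_w (h (tuple_of_family (fun i w => b i + s i * X' i w) w) `^ (1 / 2))%:E <=
   (a `^ (1 / 2) * (\prod_i ((s i * t i)^-1 * expR (b i ^+ 2 / t i ^+ 2))) `^ (1 / 2))%:E)%E.
Proof.
move=> s0 t0 st gX gX' mh h0 ha; have [mX _] := gX.
have mh12 : measurable_fun setT (fun x => (h x `^ (1 / 2))%:E).
  by apply/measurable_EFinP; exact: measurable_fun_powR.
have h12 x : (0 <= (h x `^ (1 / 2))%:E)%E by rewrite lee_fin powR_ge0.
have changeE := integral_product_density P (fun=> normal_prob 0 1)
  (fun i => normal_prob (b i) (s i)) (fun i => likelihood_ratio (b i) (s i)) X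
  (fun i w => b i + s i * X' i w) (fun x => (h x `^ (1 / 2))%:E)
  (fun i => measurable_likelihood_ratio (b i) (s i))
  (fun i => likelihood_ratio_ge0 (b i) (s i))
  (fun i => normal_prob_density (b i) (s i)) gX
  (gaussian_family_affine X' b s s0 gX') mh12 h12.
rewrite changeE.
pose Z w := \prod_i likelihood_ratio (b i) (s i) (X i w).
under eq_integral do rewrite -EFinM.
apply: (integral_sqrtM_le P (fun w => h (tuple_of_family X w)) Z) => //.
- by apply: measurableT_comp mh _; exact: measurable_tuple_of_family.
- apply: measurable_prod => i _.
  exact: measurableT_comp (measurable_likelihood_ratio _ _) (mX i).
- by move=> w; apply: prodr_ge0 => i _; exact: likelihood_ratio_ge0.
rewrite -(integral_prod_family P (fun=> normal_prob 0 1) X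
  (fun i x => likelihood_ratio (b i) (s i) x ^+ 2))//.
- by rewrite le_eqVlt; apply/orP; left; apply/eqP; apply: eq_integral => w _; rewrite /Z prodrXl.
- by move=> i; apply: measurable_funX; exact: measurable_likelihood_ratio.
- by move=> i x; exact: sqr_ge0.
- by move=> i; exact: integral_likelihood_ratio_sqr.
Qed.

End gaussian_change.

(** * Simultaneous diagonalization *)

Section spectral.
Context {R : realType}.

Lemma row_dot {m} (x y : 'rV[R]_m) : (x *m y^T) 0 0 = \sum_j x 0 j * y 0 j.
Proof. by rewrite mxE; apply: eq_bigr => j _; rewrite mxE. Qed.

Lemma row_dot_ge0 {m} (x : 'rV[R]_m) : 0 <= (x *m x^T) 0 0.
Proof. by rewrite row_dot; apply: sumr_ge0 => j _; rewrite -expr2 sqr_ge0. Qed.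

Lemma row_dot_eq0 {m} (x : 'rV[R]_m) : (x *m x^T) 0 0 = 0 -> x = 0.
Proof.
rewrite row_dot => /eqP; rewrite psumr_eq0; last by move=> j _; rewrite -expr2 sqr_ge0.
move=> /allP x0; apply/rowP => j; rewrite mxE.
by have /implyP/(_ isT) := x0 j (mem_index_enum _); rewrite mulf_eq0 orbb => /eqP.
Qed.

Lemma symmetric_dot {m} (S : 'M[R]_m) (x y : 'rV[R]_m) : S^T = S ->
  (x *m S *m y^T) 0 0 = (y *m S *m x^T) 0 0.
Proof.
move=> symS; rewrite -[LHS](mxE trmx_key (fun i j => (x *m S *m y^T) j i)).
by rewrite -/(trmx _) !trmx_mul trmxK symS mulmxA.
Qed.

(** Take a complex eigenvector [x + i y] with eigenvalue [al + i be].  Comparing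
    [x S y^T] with [y S x^T] gives [be (|x|^2 + |y|^2) = 0], so the eigenvalue
    is real and the nonzero one of [x], [y] is a real eigenvector. *)
Lemma symmetric_eigenvector {m} (S : 'M[R]_m.+1) : S^T = S ->
  exists v : 'rV[R]_m.+1, exists a : R, v != 0 /\ v *m S = a *: v.
Proof.
move=> symS.
pose A : 'M[complex R]_m.+1 := map_mx (fun x => Complex x 0) S.
have [[al be] /eigenvalueP[v vA v0]] := eigenvalue_closed A (ltn0Sn m).
pose x := map_mx (@complex.Re R) v; pose y := map_mx (@complex.Im R) v.
have ReIm j : (x *m S) 0 j = al * x 0 j - be * y 0 j /\
              (y *m S) 0 j = al * y 0 j + be * x 0 j.
  have /rowP/(_ j) := vA; rewrite !mxE => vAj.
  have ReD : {morph (@complex.Re R) : z w / z + w} by move=> [? ?] [? ?].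
  have ImD : {morph (@complex.Im R) : z w / z + w} by move=> [? ?] [? ?].
  split.
    have := congr1 (@complex.Re R) vAj; rewrite (big_morph _ ReD (erefl _)).
    move=> e; transitivity (complex.Re ((Complex al be) * v 0 j)).
      rewrite -e; apply: eq_bigr => i _; rewrite !mxE.
      by case: (v 0 i) => p q /=; rewrite mulr0 subr0.
    by case: (v 0 j).
  have := congr1 (@complex.Im R) vAj; rewrite (big_morph _ ImD (erefl _)).
  move=> e; transitivity (complex.Im ((Complex al be) * v 0 j)).
    rewrite -e; apply: eq_bigr => i _; rewrite !mxE.
    by case: (v 0 i) => p q /=; rewrite mulr0 add0r.
  by case: (v 0 j) => p q /=; rewrite addrC.
have xS : x *m S = al *: x - be *: y.
  by apply/rowP => j; have [-> _] := ReIm j; rewrite !mxE.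
have yS : y *m S = al *: y + be *: x.
  by apply/rowP => j; have [_ ->] := ReIm j; rewrite !mxE.
have xy0 : x != 0 \/ y != 0.
  have [x0|] := eqVneq x 0; last by left.
  right; apply: contra_neq v0 => y0; apply/rowP => j.
  have /rowP/(_ j) := x0; have /rowP/(_ j) := y0; rewrite !mxE.
  by case: (v 0 j) => p q /= -> ->.
have be0 : be = 0.
  have := symmetric_dot S x y symS; rewrite xS yS mulmxBl mulmxDl -!scalemxAl.
  rewrite [in X in X -> _]mxE [X in _ + X]mxE [X in X - _]mxE [X in - X]mxE.
  rewrite [in X in _ = X -> _]mxE [X in _ = X + _ -> _]mxE [X in _ = _ + X -> _]mxE.
  have -> : (y *m x^T) 0 0 = (x *m y^T) 0 0.
    by rewrite !row_dot; apply: eq_bigr => j _; rewrite mulrC.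
  move=> e; have : be * ((x *m x^T) 0 0 + (y *m y^T) 0 0) = 0 by lra.
  move/eqP; rewrite mulf_eq0 => /orP[/eqP//|].
  rewrite paddr_eq0 ?row_dot_ge0// => /andP[/eqP/row_dot_eq0 x0 /eqP/row_dot_eq0 y0].
  by case: xy0; rewrite ?x0 ?y0 eqxx.
case: xy0 => z0; [exists x|exists y]; exists al; split => //.
  by rewrite xS be0 scale0r subr0.
by rewrite yS be0 scale0r addr0.
Qed.

(** The Householder reflection exchanging [v] with the first basis vector. *)
Lemma orthogonal_first_row {m} (v : 'rV[R]_m.+1) : (v *m v^T) 0 0 = 1 ->
  exists O : 'M[R]_m.+1, O *m O^T = 1%:M /\ row 0 O = v.
Proof.
move=> vv; pose e : 'rV[R]_m.+1 := delta_mx 0 0.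
have [ve|ve] := eqVneq v e.
  by exists 1%:M; rewrite trmx1 mulmx1 row1.
pose u := v - e; pose c := (u *m u^T) 0 0.
have u0 : u != 0 by rewrite subr_eq0.
have c0 : c != 0 by apply: contra_neq u0 => /row_dot_eq0.
have uuT : u *m u^T = c%:M by rewrite [LHS]mx11_scalar.
pose N := u^T *m u; pose k := 2 / c.
have NN : N *m N = c *: N by rewrite /N mulmxA -(mulmxA u^T) uuT mul_mx_scalar scalemxAl.
pose H := 1%:M - k *: N.
have HT : H^T = H by rewrite /H linearB/= trmx1 linearZ/= trmx_mul trmxK.
exists H; split.
  rewrite HT /H mulmxBl mulmxBr mulmx1 mul1mx -scalemxAl mulmxBr mulmx1 -scalemxAr NN.
  rewrite scalerBr !scalerA -addrA -opprD -[RHS]subr0; congr (_ - _).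
  have kkc : k * k * c = k + k by rewrite /k; field.
  by rewrite kkc (scalerDl N k k) addrA subrr.
have cE : c = 2 - 2 * v 0 0.
  rewrite /c /u linearB/= mulmxBl !mulmxBr.
  have ee : (e *m e^T) 0 0 = 1 by rewrite trmx_delta mul_delta_mx mxE !eqxx.
  have ve' : (v *m e^T) 0 0 = v 0 0 by rewrite trmx_delta -colE mxE.
  have ev : (e *m v^T) 0 0 = v 0 0 by rewrite -rowE !mxE.
  rewrite !mxE in vv ee ve' ev *; rewrite vv ee ve' ev; ring.
have eN : e *m N = (v 0 0 - 1) *: u.
  rewrite /N mulmxA -rowE [row _ _]mx11_scalar mul_scalar_mx; congr (_ *: _).
  by rewrite !mxE !eqxx.
rewrite rowE -/e /H mulmxBr mulmx1 -scalemxAr eN scalerA.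
have -> : k * (v 0 0 - 1) = -1.
  by rewrite /k; move: c0; rewrite cE => c0; field.
by rewrite scaleN1r opprK /u addrC subrK.
Qed.

(** Completing a unit eigenvector to an orthogonal matrix splits off a block of
    size one; induction handles the remaining symmetric block. *)
Theorem spectral_theorem {m} (S : 'M[R]_m) : S^T = S ->
  exists O : 'M[R]_m, exists l : 'rV[R]_m,
    O *m O^T = 1%:M /\ O *m S *m O^T = diag_mx l.
Proof.
elim: m S => [|m IH] S symS.
  by exists 0; exists 0; split; apply/matrixP => -[].
have [w [a [w0 wS]]] := symmetric_eigenvector S symS.
pose nw := Num.sqrt ((w *m w^T) 0 0).
have ww : 0 < (w *m w^T) 0 0.
  by rewrite lt0r row_dot_ge0 andbT; apply: contra_neq w0 => /row_dot_eq0.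
have nw0 : nw != 0 by rewrite gt_eqF// sqrtr_gt0.
pose v := nw^-1 *: w.
have v1 : (v *m v^T) 0 0 = 1.
  rewrite /v linearZ/= -scalemxAl -scalemxAr scalerA mxE -invfM -expr2.
  by rewrite sqr_sqrtr ?ltW// mulVf// gt_eqF.
have vSa : v *m S = a *: v by rewrite /v -scalemxAl wS !scalerA mulrC.
have [U1 [UU1 U1v]] := orthogonal_first_row v v1.
pose S1 : 'M[R]_(1 + m) := U1 *m S *m U1^T.
have symS1 : S1^T = S1 by rewrite /S1 !trmx_mul trmxK symS mulmxA.
have row_S1 : row 0 S1 = a *: row 0 1%:M.
  rewrite /S1 !row_mul U1v vSa -scalemxAl; congr (_ *: _).
  by rewrite -U1v -row_mul UU1.
have ur0 : ursubmx S1 = 0.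
  apply/rowP => j; have /rowP/(_ (rshift 1 j)) := row_S1; rewrite !mxE.
  rewrite (_ : (0 == rshift 1 j :> 'I_(1 + m)) = false) ?mulr0 //.
  by rewrite (_ : lshift m (0 : 'I_1) = 0)//; apply/val_inj.
have dlS1 : dlsubmx S1 = 0 by rewrite -[S1]symS1 -trmx_ursub ur0 trmx0.
have symS2 : (drsubmx S1)^T = drsubmx S1 by rewrite trmx_drsub symS1.
have [U2 [l2 [UU2 US2]]] := IH _ symS2.
pose Q : 'M[R]_(1 + m) := block_mx 1%:M 0 0 U2.
have QT : Q^T = block_mx 1%:M 0 0 U2^T by rewrite tr_block_mx !trmx0 trmx1.
have QQ : Q *m Q^T = 1%:M.
  rewrite QT mulmx_block.
  by rewrite !mulmx0 !mul0mx !addr0 !add0r mulmx1 UU2 -scalar_mx_block.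
have QSQ : Q *m S1 *m Q^T = diag_mx (row_mx (ulsubmx S1) l2).
  rewrite -[S1]submxK ur0 dlS1 QT mulmx_block.
  rewrite !mulmx0 !mul0mx !addr0 !add0r mul1mx mulmx_block.
  rewrite !mulmx0 !mul0mx !addr0 !add0r mulmx1 US2 diag_mx_row block_mxKul.
  by congr block_mx; apply/matrixP => i j; rewrite [RHS]mxE !ord1 eqxx.
exists (Q *m U1); exists (row_mx (ulsubmx S1) l2); split.
  by rewrite trmx_mul mulmxA -(mulmxA Q) UU1 mulmx1.
by rewrite -QSQ /S1 trmx_mul !mulmxA.
Qed.

Lemma pos_def_factor {m} (S : 'M[R]_m) : pos_def S ->
  exists T : 'M[R]_m, T \in unitmx /\ S = T *m T^T.
Proof.
move=> [symS posS]; have [Q [l [QQ QS]]] := spectral_theorem S symS.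
have QTQ : Q^T *m Q = 1%:M by exact: mulmx1C.
have l0 i : 0 < l 0 i.
  have -> : l 0 i = qform S (row i Q)^T.
    rewrite /qform trmxK -row_mul; transitivity ((Q *m S *m Q^T) i i).
      by rewrite QS mxE eqxx mulr1n.
    rewrite [LHS]mxE [RHS]mxE; apply: eq_bigr => j _.
    by rewrite [row _ _ _ _]mxE; congr (_ * _); rewrite !mxE.
  apply: posS; apply/eqP => Qi.
  have /matrixP/(_ i i) := QQ; rewrite !mxE eqxx big1 => [/eqP|j _].
    by rewrite eq_sym oner_eq0.
  by have /colP/(_ j) := Qi; rewrite !mxE => ->; rewrite mul0r.
pose D : 'M[R]_m := diag_mx (\row_i Num.sqrt (l 0 i)).
pose D' : 'M[R]_m := diag_mx (\row_i (Num.sqrt (l 0 i))^-1).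
have DD' : D *m D' = 1%:M.
  rewrite mulmx_diag -diag_const_mx; congr diag_mx; apply/rowP => i; rewrite !mxE.
  by rewrite divff// gt_eqF// sqrtr_gt0.
have DD : D *m D = diag_mx l.
  rewrite mulmx_diag; congr diag_mx; apply/rowP => i; rewrite !mxE.
  by rewrite -expr2 sqr_sqrtr// ltW.
exists (Q^T *m D); split.
  have : (Q^T *m D) *m (D' *m Q) = 1%:M by rewrite mulmxA -(mulmxA Q^T) DD' mulmx1.
  by case/mulmx1_unit.
rewrite trmx_mul trmxK tr_diag_mx mulmxA -(mulmxA Q^T) DD -QS.
by rewrite !mulmxA QTQ mul1mx -mulmxA QTQ mulmx1.
Qed.

(** Write [S = T T^T] and diagonalize [T^{-1} S0 T^{-T}] by an orthogonal [Q];
    then [M = T Q^T]. *)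
Lemma simultaneous_diagonalization {m} (S S0 : 'M[R]_m) : pos_def S -> S0^T = S0 ->
  exists M : 'M[R]_m, exists l : 'rV[R]_m,
    [/\ M \in unitmx, S = M *m M^T & S0 = M *m diag_mx l *m M^T].
Proof.
move=> posS symS0; have [T [uT ST]] := pos_def_factor S posS.
pose S1 := invmx T *m S0 *m (invmx T)^T.
have symS1 : S1^T = S1 by rewrite /S1 !trmx_mul trmxK symS0 mulmxA.
have [Q [l [QQ QS]]] := spectral_theorem S1 symS1.
have QTQ : Q^T *m Q = 1%:M by exact: mulmx1C.
exists (T *m Q^T); exists l; split.
- have : (T *m Q^T) *m (Q *m invmx T) = 1%:M.
    by rewrite mulmxA -(mulmxA T) QTQ mulmx1 mulmxV.
  by case/mulmx1_unit.
- by rewrite trmx_mul trmxK mulmxA -(mulmxA T) QTQ mulmx1.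
rewrite -QS /S1 trmx_mul trmxK !mulmxA -(mulmxA T) QTQ mulmx1.
rewrite mulmxV// mul1mx -!mulmxA (mulmxA Q^T) QTQ mul1mx.
by rewrite -trmx_mul mulmxV// trmx1 mulmx1.
Qed.

End spectral.

(** * Change of measure between Gaussian vectors *)

Lemma std_gaussian_family {d} {T : measurableType d} {R : realType} {P : probability T R}
    {n} (eps : 'I_n -> {RV P >-> R}) :
  std_gaussian eps -> gaussian_family P (fun i => eps i : T -> R).
Proof.
move=> [ind law]; split=> [i|A mA]; first exact: measurable_funP.
have := ind [set: 'I_n]%SET A mA.
rewrite (_ : [set` [set: 'I_n]%SET] = setT); last first.
  by apply/seteqP; split => // i _ /=; rewrite inE.
move=> indA; transitivity (\prod_(i in [set: 'I_n]%SET) P (eps i @^-1` A i))%E.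
  exact: indA.
rewrite (eq_bigr (fun i => (fine (normal_prob 0 1 (A i)))%:E)).
  rewrite (big_morph EFin EFinM (erefl _)).
  by apply: eq_bigl => i; rewrite inE.
move=> i _; rewrite -(law i)// fineK//.
by apply: fin_num_measure; exact: mA.
Qed.

Section change_of_measure.
Context {R : realType}.

Lemma diagf_mul {n} (x y : 'I_n -> R) : diagf x *m diagf y = diagf (fun i => x i * y i).
Proof. by rewrite mulmx_diag; congr diag_mx; apply/rowP => i; rewrite !mxE. Qed.

Lemma diagf_sqr {n} (x : 'I_n -> R) : diagf x *m diagf x = diagf (fun i => x i ^+ 2).
Proof. exact: diagf_mul. Qed.

Lemma diagf_tr {n} (x : 'I_n -> R) : (diagf x)^T = diagf x.
Proof. exact: tr_diag_mx. Qed.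

Lemma diagf1 {n} : diagf (fun=> 1) = 1%:M :> 'M[R]_n.
Proof. by rewrite -diag_const_mx; congr diag_mx; apply/rowP => i; rewrite !mxE. Qed.

Lemma qform_diagf {n m} (D : 'M[R]_(m, n)) (x : 'I_n -> R) (v : 'cV[R]_m) :
  qform (D *m diagf x *m D^T) v = \sum_j x j * ((D^T *m v) j 0) ^+ 2.
Proof.
have -> : qform (D *m diagf x *m D^T) v =
    ((D^T *m v)^T *m diagf x *m (D^T *m v)) 0 0.
  by rewrite /qform trmx_mul trmxK !mulmxA.
move: (D^T *m v) => z; rewrite mxE; apply: eq_bigr => j _.
by rewrite mul_mx_diag !mxE; ring.
Qed.

Lemma orthonormal_rowsP {m n} (U : 'M[R]_(m, n)) : U *m U^T = 1%:M -> orthonormal_rows U.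
Proof.
move=> UU i k; have /matrixP/(_ i k) := UU; rewrite !mxE => <-.
by apply: eq_bigr => j _; rewrite mxE.
Qed.

Lemma measurable_comp_col {d} {T : measurableType d} {n} (Y : T -> 'cV[R]_n) (h : 'cV[R]_n -> R) :
    measurable_fun setT (fun x : n.-tuple R => h (\col_i tnth x i)) ->
    (forall i, measurable_fun setT (fun t => Y t i 0)) ->
  measurable_fun setT (fun t => h (Y t)).
Proof.
move=> mh mY.
rewrite (_ : (fun t => h (Y t)) = (fun x : n.-tuple R => h (\col_i tnth x i)) \o
    tuple_of_family (fun i t => Y t i 0)).
  by apply: measurableT_comp mh _; exact: measurable_tuple_of_family.
apply/funext => t /=; congr h; apply/colP => i.
by rewrite mxE tnth_mktuple.
Qed.

Lemma expR_powR12 (x : R) : expR x `^ (1 / 2) = expR (x / 2).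
Proof. by rewrite /powR gt_eqF ?expR_gt0// expRK mul1r mulrC. Qed.

(** The inequality between [N(mu, Sigma)] and [N(f, Sigma_0)] for a function
    [h] that factors through [D].  In the coordinates [M^{-1} D y] both laws are
    those of affine images, with diagonal matrices, of standard Gaussian
    families [X] and [X0], and [gaussian_sqrt_change] applies.  For each
    eigenvalue, [l (2 - l) >= 1 - delta^2 >= (1 - delta)^3 / (1 + delta)] and
    [2 - l >= 1 - delta]. *)
Lemma gaussE_change_of_measure {d} {T : measurableType d} (P : probability T R)
    {n m} (eps : 'I_n -> {RV P >-> R}) (sigma sigma0 : 'I_n -> R) (delta a : R)
    (D : 'M[R]_(m, n)) (f mu : 'cV[R]_n) (h : 'cV[R]_n -> R) :
    std_gaussian eps -> (forall i, 0 < sigma i) -> (forall i, 0 < sigma0 i) ->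
    0 <= delta < 1 ->
    (forall i, 1 - delta <= sigma0 i ^+ 2 / sigma i ^+ 2 <= 1 + delta) ->
    let S := D *m diagf (fun i => sigma i ^+ 2) *m D^T in
    pos_def S ->
    measurable_fun setT (fun x : n.-tuple R => h (\col_i tnth x i)) ->
    (forall y, 0 <= h y) -> (forall y y', D *m y = D *m y' -> h y = h y') ->
    (gaussE eps mu sigma h <= a%:E)%E ->
  (gaussE eps f sigma0 (fun y => h y `^ (1 / 2))%R <=
   (a `^ (1 / 2) * ((1 + delta) / (1 - delta) ^+ 3) `^ (m%:R / 4) *
    expR (qform (invmx S) (D *m (f - mu)) / (2 * (1 - delta))))%:E)%E.
Proof.
move=> std s_gt0 s0_gt0 /andP[d0 d1] A3 S posS mh h0 hD ha.
have geps := std_gaussian_family eps std.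
pose S0 := D *m diagf (fun i => sigma0 i ^+ 2) *m D^T.
have symS0 : S0^T = S0 by rewrite /S0 !trmx_mul trmxK diagf_tr mulmxA.
have [M [l [uM SM S0M]]] := simultaneous_diagonalization S S0 posS symS0.
pose N := invmx M.
have NM : N *m M = 1%:M by exact: mulVmx.
have MN : M *m N = 1%:M by exact: mulmxV.
have NSN : N *m S *m N^T = 1%:M.
  by rewrite SM mulmxA NM mul1mx -trmx_mul NM trmx1.
have NS0N : N *m S0 *m N^T = diag_mx l.
  by rewrite S0M !mulmxA NM mul1mx -mulmxA -trmx_mul NM trmx1 mulmx1.
(* [l 0 i] is the value of the form [S0] at a vector where [S] takes the value 1. *)
have lE i : 1 - delta <= l 0 i <= 1 + delta.
  pose v : 'cV[R]_m := (row i N)^T.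
  have qv (Z : 'M[R]_m) : qform Z v = (N *m Z *m N^T) i i.
    rewrite /qform /v trmxK -row_mul [LHS]mxE [RHS]mxE; apply: eq_bigr => j _.
    by rewrite [row _ _ _ _]mxE; congr (_ * _); rewrite !mxE.
  have := qv S; rewrite NSN mxE eqxx qform_diagf => qS.
  have := qv S0; rewrite NS0N mxE eqxx mulr1n qform_diagf => <-.
  have sb j : (1 - delta) * sigma j ^+ 2 <= sigma0 j ^+ 2 <= (1 + delta) * sigma j ^+ 2.
    have := A3 j; rewrite ler_pdivlMr ?ler_pdivrMr//; exact: exprn_gt0.
  have scale (c : R) : c = \sum_j c * (sigma j ^+ 2 * ((D^T *m v) j 0) ^+ 2).
    by rewrite -mulr_sumr qS mulr1.
  apply/andP; split; [rewrite (scale (1 - delta))|rewrite (scale (1 + delta))].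
    by apply: ler_sum => j _; rewrite mulrA ler_wpM2r ?sqr_ge0//; have /andP[] := sb j.
  by apply: ler_sum => j _; rewrite mulrA ler_wpM2r ?sqr_ge0//; have /andP[] := sb j.
have l_gt0 i : 0 < l 0 i by have /andP[+ _] := lE i; apply: lt_le_trans; rewrite subr_gt0.
have l_lt2 i : l 0 i < 2.
  by have /andP[_ +] := lE i; move=> /le_lt_trans; apply; lra.
pose s i := Num.sqrt (l 0 i); pose t i := Num.sqrt (2 - l 0 i).
have s_pos i : 0 < s i by rewrite sqrtr_gt0.
have t_pos i : 0 < t i by rewrite sqrtr_gt0 subr_gt0.
have s2 i : s i ^+ 2 = l 0 i by rewrite sqr_sqrtr// ltW.
have t2 i : t i ^+ 2 = 2 - l 0 i by rewrite sqr_sqrtr// subr_ge0 ltW.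
pose U := N *m D *m diagf sigma.
pose U0 := diagf (fun i => (s i)^-1) *m N *m D *m diagf sigma0.
have UU : U *m U^T = 1%:M.
  by rewrite -NSN /S /U !trmx_mul diagf_tr -diagf_sqr !mulmxA.
have UU0 : U0 *m U0^T = 1%:M.
  transitivity (diagf (fun i => (s i)^-1) *m (N *m S0 *m N^T) *m diagf (fun i => (s i)^-1)).
    by rewrite /U0 /S0 !trmx_mul !diagf_tr -diagf_sqr !mulmxA.
  rewrite NS0N [diag_mx l](_ : _ = diagf (fun i => l 0 i)); last first.
    by congr diag_mx; apply/rowP => i; rewrite mxE.
  rewrite !diagf_mul -[RHS]diagf1; congr diagf; apply/funext => i.
  by rewrite -s2; field; rewrite gt_eqF.
pose X := mix U (fun i => eps i : T -> R).
pose X0 := mix U0 (fun i => eps i : T -> R).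
have gX : gaussian_family P X.
  by apply: gaussian_family_orthonormal => //; exact: orthonormal_rowsP.
have gX0 : gaussian_family P X0.
  by apply: gaussian_family_orthonormal => //; exact: orthonormal_rowsP.
(* A section of [D] up to the change of basis: [mu + Rr x] is one vector among
   those that [D] maps to [D mu + M x], and [h] does not see which one. *)
pose Rr := diagf (fun i => sigma i ^+ 2) *m D^T *m N^T.
have DR : D *m Rr = M.
  by rewrite /Rr !mulmxA -/S SM -mulmxA -trmx_mul NM trmx1 mulmx1.
pose b := N *m (D *m (f - mu)).
pose G (x : m.-tuple R) := h (mu + Rr *m \col_i tnth x i).
have colE (Z : 'M[R]_(m, n)) w : \col_i (mix Z (fun i => eps i : T -> R) i w) =
    Z *m \col_i eps i w.
  by apply/colP => i; rewrite !mxE; apply: eq_bigr => j _; rewrite mxE.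
have colT (Z : 'I_m -> T -> R) w :
    \col_i tnth (tuple_of_family Z w) i = \col_i Z i w.
  by apply/colP => i; rewrite !mxE tnth_mktuple.
have GX w : h (mu + diagf sigma *m \col_i eps i w) = G (tuple_of_family X w).
  apply: hD; rewrite /G colT colE !mulmxDr; congr (_ + _).
  by rewrite (mulmxA D Rr) DR /U !mulmxA MN mul1mx.
have GX0 w : h (f + diagf sigma0 *m \col_i eps i w) =
    G (tuple_of_family (fun i w => b i 0 + s i * X0 i w) w).
  apply: hD; rewrite /G colT.
  have -> : \col_i (b i 0 + s i * X0 i w) = b + diagf s *m (U0 *m \col_i eps i w).
    rewrite -colE; apply/colP => i; rewrite [LHS]mxE [RHS]mxE; congr (_ + _).
    by rewrite mul_diag_mx !mxE.
  rewrite !mulmxDr (mulmxA D Rr b) (mulmxA D Rr (diagf s *m _)) DR /b !mulmxA MN mul1mx.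
  rewrite -(mulmxA M) diagf_mul (_ : diagf (fun i => s i * (s i)^-1) = 1%:M); last first.
    by rewrite -diagf1; congr diagf; apply/funext => i; rewrite divff// gt_eqF.
  by rewrite mulmx1 MN mul1mx addrA mulmxBr [D *m mu + _]addrC subrK.
have -> : gaussE eps f sigma0 (fun y => h y `^ (1 / 2)) =
   (\int[P]_w (G (tuple_of_family (fun i w => (b i 0) + s i * X0 i w) w) `^ (1 / 2))%:E)%E.
  by rewrite /gaussE unlock; apply: eq_integral => w _; rewrite GX0.
have ha' : (\int[P]_w (G (tuple_of_family X w))%:E <= a%:E)%E.
  by move: ha; rewrite /gaussE unlock; under eq_integral do rewrite GX.
have mG : measurable_fun setT G.
  apply: (measurable_comp_col (fun x : m.-tuple R => mu + Rr *m \col_i tnth x i) h mh).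
  move=> i; rewrite (_ : (fun x => _) =
      (fun x : m.-tuple R => mu i 0 + \sum_j Rr i j * tnth x j)); last first.
    apply/funext => x; rewrite [LHS]mxE [X in _ + X]mxE; congr (_ + _).
    by apply: eq_bigr => j _; congr (_ * _); rewrite mxE.
  apply: measurable_funD => //; apply: measurable_sum => j.
  by apply: measurable_funM => //; exact: measurable_tnth.
have st i : s i ^+ 2 + t i ^+ 2 = 2 by rewrite s2 t2 addrC subrK.
have G0 x : 0 <= G x by exact: h0.
apply: (le_trans (gaussian_sqrt_change P X X0 (fun i => b i 0) s t G a
  s_pos t_pos st gX gX0 mG G0 ha')).
rewrite lee_fin -mulrA ler_wpM2l ?powR_ge0//.
have -> : qform (invmx S) (D *m (f - mu)) = \sum_i b i 0 ^+ 2.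
  have SNN : S *m (N^T *m N) = 1%:M.
    by rewrite SM mulmxA -(mulmxA M) -trmx_mul NM trmx1 mulmx1 MN.
  have [uS _] := mulmx1_unit SNN.
  have -> : invmx S = N^T *m N by rewrite -[LHS]mulmx1 -SNN mulmxA mulVmx// mul1mx.
  have -> : qform (N^T *m N) (D *m (f - mu)) = (b^T *m b) 0 0.
    by rewrite /qform /b; move: (D *m (f - mu)) => e; rewrite trmx_mul !mulmxA.
  by rewrite mxE; apply: eq_bigr => i _; rewrite mxE expr2.
set g := (1 + delta) / (1 - delta) ^+ 3.
have dd : 0 < 1 - delta by rewrite subr_gt0.
have g0 : 0 < g by rewrite divr_gt0 ?exprn_gt0//; lra.
pose q := \sum_i b i 0 ^+ 2.
have step1 : \prod_i ((s i * t i)^-1 * expR (b i 0 ^+ 2 / t i ^+ 2)) <=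
    (g `^ (1 / 2)) ^+ m * expR (q / (1 - delta)).
  have -> : (g `^ (1 / 2)) ^+ m * expR (q / (1 - delta)) =
      \prod_(i < m) (g `^ (1 / 2) * expR (b i 0 ^+ 2 / (1 - delta))).
    rewrite big_split/= prodr_const card_ord; congr (_ * _).
    by rewrite /q mulr_suml expR_sum.
  apply: ler_prod => i _; have st0 : 0 < s i * t i by exact: mulr_gt0.
  rewrite mulr_ge0 ?expR_ge0 ?invr_ge0 ?(ltW st0)//=.
  have /andP[l1 l2] := lE i.
  apply: ler_pM; rewrite ?expR_ge0 ?invr_ge0 ?(ltW st0)//; last first.
    rewrite ler_expR ler_wpM2l ?sqr_ge0// lef_pV2 ?posrE ?t2//; last by rewrite subr_gt0.
    by lra.
  have -> : g `^ (1 / 2) = Num.sqrt g by rewrite mul1r powR12_sqrt ?ltW.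
  have -> : (s i * t i)^-1 = Num.sqrt ((l 0 i * (2 - l 0 i))^-1).
    by rewrite -t2 -s2 -exprMn -exprVn sqrtr_sqr ger0_norm// invr_ge0 ltW.
  rewrite ler_sqrt; last exact: ltW.
  have ll : (1 - delta) ^+ 3 / (1 + delta) <= l 0 i * (2 - l 0 i).
    rewrite ler_pdivrMr; last by lra.
    have h1 : 0 <= (l 0 i - (1 - delta)) * ((1 + delta) - l 0 i) by rewrite mulr_ge0 ?subr_ge0.
    have h2 : (1 - delta) * (1 + delta) <= l 0 i * (2 - l 0 i).
      rewrite -subr_ge0; apply: le_trans h1 _; rewrite le_eqVlt; apply/orP; left.
      by apply/eqP; ring.
    have h3 : 0 <= (1 - delta) * (4 * delta) by apply: mulr_ge0; [exact: ltW|apply: mulr_ge0].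
    apply: (@le_trans _ _ ((1 - delta) * (1 + delta) * (1 + delta))).
      rewrite -subr_ge0; apply: le_trans h3 _; rewrite le_eqVlt; apply/orP; left.
      by apply/eqP; ring.
    by rewrite ler_wpM2r//; lra.
  rewrite /g -[leRHS]invrK lef_pV2 ?posrE.
  - by rewrite invfM invrK mulrC.
  - by rewrite mulr_gt0// subr_gt0.
  - by rewrite invr_gt0.
have h12 : 0 <= 1 / 2 :> R by [].
apply: (le_trans (ge0_ler_powR h12 _ _ step1)).
- by rewrite nnegrE; apply: prodr_ge0 => i _; rewrite mulr_ge0 ?expR_ge0 ?invr_ge0 ?mulr_ge0 ?ltW.
- by rewrite nnegrE mulr_ge0 ?expR_ge0 ?exprn_ge0 ?powR_ge0.
rewrite powRM ?expR_ge0 ?exprn_ge0 ?powR_ge0//.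
have -> : ((g `^ (1 / 2)) ^+ m) `^ (1 / 2) = g `^ (m%:R / 4).
  by rewrite -powR_mulrn ?powR_ge0// -!powRrM; congr (_ `^ _); field.
rewrite expR_powR12 -/q; apply: ler_wpM2l; first exact: powR_ge0.
rewrite (_ : q / (1 - delta) / 2 = q / (2 * (1 - delta))) ?lexx//.
by rewrite -mulrA invfM [2^-1 * _]mulrC.
Qed.

End change_of_measure.

(** * The joint law of the estimators *)

Section stacked.
Context {R : realType}.

(** The matrix that sends [y] to the estimators at the scales [1, ..., k]. *)
Definition stacked_D {n p} (Psi : 'M[R]_(p, n)) (W : nat -> 'M[R]_n) (k : nat)
    : 'M[R]_(\sum_(l < k) p, n) :=
  \mxcol_(l < k) Dmx Psi W l.+1.

(** The Kronecker product with the all-ones matrix is [E Sigma E^T] with [E] a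
    column of identity blocks, and the block diagonal matrix of the [D_l] times
    [E] is [stacked_D]. *)
Lemma joint_covE {n p} (Psi : 'M[R]_(p, n)) (W : nat -> 'M[R]_n) (Sigma : 'M[R]_n) k :
  joint_cov Psi W Sigma k = stacked_D Psi W k *m Sigma *m (stacked_D Psi W k)^T.
Proof.
rewrite /joint_cov /=.
set Dk := (X in X *m _ *m _^T); set J := (X in _ *m X *m _).
pose E : 'M[R]_(\sum_(l < k) n, n) := \mxcol_(l < k) 1%:M.
have JE : J = E *m Sigma *m E^T.
  rewrite /E mxcol_mul tr_mxcol mul_mxcol_mxrow; apply: eq_mxblock => i j.
  by rewrite mul1mx trmx1 mulmx1.
have DE : Dk *m E = stacked_D Psi W k.
  rewrite /Dk /E mul_mxblock_mxrow; apply: eq_mxcol => i.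
  rewrite (bigD1 i)//= eqxx mulmx1 big1 ?addr0// => j ji.
  by rewrite eq_sym (negbTE ji) mul0mx.
by rewrite JE -DE trmx_mul !mulmxA.
Qed.

Lemma stacked_D_trmul {n p} (Psi : 'M[R]_(p, n)) (W : nat -> 'M[R]_n) k
    (v : nat -> 'cV[R]_p) :
  (stacked_D Psi W k)^T *m (\mxcol_(l < k) v l) =
  \sum_(l < k) (Dmx Psi W l.+1)^T *m v l.
Proof. by rewrite tr_mxcol mul_mxrow_mxcol. Qed.

Lemma mxcol_nat {p k} (v : 'cV[R]_(\sum_(l < k) p)) :
  exists v' : nat -> 'cV[R]_p, v = \mxcol_(l < k) v' l.
Proof.
exists (fun l => if insub l is Some i then submxcol v i else 0).
rewrite -[LHS]submxcolK; apply: eq_mxcol => i.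
by rewrite valK.
Qed.

(** Positivity for [K] says that the transpose of [stacked_D] is injective; a
    vector with [k] blocks is padded by zero blocks to one with [K] blocks. *)
Lemma joint_cov_pos_def {n p} (Psi : 'M[R]_(p, n)) (W : nat -> 'M[R]_n) (x : 'I_n -> R) k K :
    (k <= K)%N ->
  pos_def (joint_cov Psi W (diagf x) K) -> pos_def (joint_cov Psi W (diagf x) k).
Proof.
move=> kK; rewrite !joint_covE => -[_ posK]; split.
  by rewrite !trmx_mul trmxK diagf_tr mulmxA.
move=> v v0; have [v' vE] := mxcol_nat v.
pose v2 l := if (l < k)%N then v' l else 0.
have v20 : \mxcol_(l < K) v2 l != 0.
  apply: contra_neq v0 => v2E.
  rewrite vE -[RHS]submxcolK; apply: eq_mxcol => i.
  have := congr1 (fun c => submxcol c (widen_ord kK i)) v2E.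
  rewrite mxcolK /v2 /= ltn_ord => ->.
  by apply/matrixP => a b; rewrite !mxE.
have := posK _ v20; rewrite !qform_diagf vE !stacked_D_trmul.
suff -> : \sum_(l < K) (Dmx Psi W l.+1)^T *m v2 l = \sum_(l < k) (Dmx Psi W l.+1)^T *m v' l by [].
rewrite (big_ord_widen K (fun l => (Dmx Psi W l.+1)^T *m v' l) kK) [RHS]big_mkcond/=.
by apply: eq_bigr => l _; rewrite /v2; case: ifP => //; rewrite mulmx0.
Qed.

Lemma pos_def_unit {m} (S : 'M[R]_m) : pos_def S -> S \in unitmx.
Proof.
by move=> /pos_def_factor[T [uT ->]]; rewrite unitmx_mul uT unitmx_tr.
Qed.

Lemma pos_def_qform_ge0 {m} (S : 'M[R]_m) v : pos_def S -> 0 <= qform S v.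
Proof.
move=> [_ posS]; have [->|/posS/ltW//] := eqVneq v 0.
by rewrite /qform mulmx0 mxE.
Qed.

End stacked.

(** * The acceptance rule and the truncated loss *)

(** Both the selected index and the oracle index are maxima of this kind. *)
Lemma bigmax_nat_attained (r : seq nat) (Q : pred nat) :
  (0 < \max_(k <- r | Q k) k)%N ->
  \max_(k <- r | Q k) k \in r /\ Q (\max_(k <- r | Q k) k).
Proof.
elim: r => [|k r IH]; first by rewrite big_nil.
rewrite big_cons; case: ifP => Qk; last first.
  by move=> /IH[? ?]; rewrite in_cons orbC; split => //; apply/orP; left.
rewrite /maxn; case: ifP => [kr _|_ _]; last by rewrite mem_head.
have [|? ?] := IH; first exact: leq_ltn_trans kr.
by rewrite in_cons orbC; split => //; apply/orP; left.
Qed.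

(** The condition whose largest index in [1, K] is the selected one. *)
Definition accepted {R : realType} {n p} (Psi : 'M[R]_(p, n)) (W : nat -> 'M[R]_n)
    (z : nat -> R) k (y : 'cV[R]_n) : Prop :=
  forall l m, (1 <= l)%N -> (l < m)%N -> (m <= k)%N -> test_stat Psi W l m y <= z l.

Section acceptance.
Context {R : realType} {n p K : nat} (Psi : 'M[R]_(p, n)) (W : nat -> 'M[R]_n) (z : nat -> R).
Hypothesis K_gt0 : (0 < K)%N.
Let kh := khat K Psi W z.
Let accepted := accepted Psi W z.

Lemma acceptedW j k y : (j <= k)%N -> accepted k y -> accepted j y.
Proof. by move=> jk ak l m l1 lm mj; apply: ak => //; exact: leq_trans jk. Qed.

Lemma accepted_le_khat k y : (1 <= k <= K)%N -> accepted k y -> (k <= kh y)%N.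
Proof.
move=> kK ak; rewrite /kh /khat.
apply: (leq_bigmax_seq (F := fun i => i)); first by rewrite mem_index_iota ltnS.
by apply/asboolP.
Qed.

Lemma khatP y : (1 <= kh y <= K)%N /\ accepted (kh y) y.
Proof.
have a1 : accepted 1 y by move=> l m l1 lm m1; have := leq_trans lm m1; rewrite ltnS leqNgt l1.
have k1 : (0 < kh y)%N by apply: accepted_le_khat.
have := bigmax_nat_attained _ _ k1; rewrite -/(kh y) mem_index_iota ltnS => -[kK ak].
by split => //; exact/asboolP.
Qed.

(** Acceptance at a level [j <= k] involves only the estimators up to [k], and
    acceptance is inherited by smaller levels. *)
Lemma minn_khat_ext k y y' : (k <= K)%N ->
    (forall l, (1 <= l <= k)%N -> thetat Psi W l y = thetat Psi W l y') ->
  minn k (kh y) = minn k (kh y').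
Proof.
suff le y1 y2 : (k <= K)%N ->
    (forall l, (1 <= l <= k)%N -> thetat Psi W l y1 = thetat Psi W l y2) ->
    (minn k (kh y1) <= minn k (kh y2))%N.
  move=> kK yy'; apply/eqP; rewrite eqn_leq le// le// => l lk.
  by rewrite yy'.
move=> kK yy; rewrite leq_min geq_minl/=.
have [->|k0] := posnP k; first by rewrite min0n.
have [/andP[kh1 khK] ak] := khatP y1.
apply: accepted_le_khat.
  by rewrite leq_min k0 kh1 (leq_trans (geq_minr _ _) khK).
move=> l m l1 lm mj; have lk : (l < k)%N by rewrite (leq_trans lm)// (leq_trans mj)// geq_minl.
rewrite /test_stat -!yy.
- by apply: ak => //; rewrite (leq_trans mj)// geq_minr.
- by rewrite (leq_trans l1 (ltnW lm))/= (leq_trans mj)// geq_minl.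
- by rewrite l1 ltnW.
Qed.

End acceptance.

Definition loss {R : realType} {n p} K (Psi : 'M[R]_(p, n)) (W : nat -> 'M[R]_n)
    (z : nat -> R) k r (y : 'cV[R]_n) : R :=
  `|qform (Bmx Psi W k) (thetat Psi W k y - theta_hat_k K Psi W z k y)| `^ r.

Lemma lossE {R : realType} {n p} K (Psi : 'M[R]_(p, n)) (W : nat -> 'M[R]_n)
    (z : nat -> R) k r (y : 'cV[R]_n) :
  loss K Psi W z k r y = `|qform (Bmx Psi W k) (thetat Psi W k y -
    thetat Psi W (minn k (khat K Psi W z y)) y)| `^ r.
Proof. by []. Qed.

Lemma loss_ext {R : realType} {n p K} (Psi : 'M[R]_(p, n)) (W : nat -> 'M[R]_n)
    (z : nat -> R) k r (y y' : 'cV[R]_n) :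
    (0 < K)%N -> (1 <= k <= K)%N -> stacked_D Psi W k *m y = stacked_D Psi W k *m y' ->
  loss K Psi W z k r y = loss K Psi W z k r y'.
Proof.
move=> K0 /andP[k1 kK] yy.
have tE l : (1 <= l <= k)%N -> thetat Psi W l y = thetat Psi W l y'.
  case: l => // l lk.
  have := congr1 (fun c => submxcol c (Ordinal lk)) yy.
  by rewrite /stacked_D !mxcol_mul !mxcolK.
rewrite !lossE (minn_khat_ext Psi W z K0 k y y' kK tE).
have kk : (1 <= k <= k)%N by rewrite k1 leqnn.
have jk : (1 <= minn k (khat K Psi W z y') <= k)%N.
  have [/andP[kh1 _] _] := khatP Psi W z K0 y'.
  by rewrite leq_min k1 kh1 geq_minl.
by rewrite (tE k kk) (tE _ jk).
Qed.

Section estimators.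
Context {R : realType} {n p K : nat} (Psi : 'M[R]_(p, n)) (sigma : 'I_n -> R)
  (w : nat -> 'I_n -> R) (z : nat -> R).
Hypothesis sigma_gt0 : forall i, 0 < sigma i.
Hypothesis w01 : forall k i, (1 <= k <= K)%N -> 0 <= w k i <= 1.
Hypothesis A1 : row_free (Psi *m diagf (w 1%N)).
Hypothesis A2 : forall l k i, (1 <= l)%N -> (l <= k)%N -> (k <= K)%N -> w l i <= w k i.
Hypothesis K_gt0 : (0 < K)%N.
Let W := weight_mx sigma w.
Let B := Bmx Psi W.

Lemma weight_mxE k : W k = diagf (fun i => w k i / sigma i ^+ 2).
Proof.
rewrite /W /weight_mx !diagf_mul; congr diagf; apply/funext => i.
by rewrite expr2 invfM mulrA [_^-1 * w k i]mulrC.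
Qed.

(** The weights increase with the scale, so a vector on which the form of [B k]
    vanishes is killed by [Psi] weighted at the first scale, which has full
    row rank. *)
Lemma Bmx_pos_def k : (1 <= k <= K)%N -> pos_def (B k).
Proof.
move=> kK; rewrite /B /Bmx weight_mxE; split.
  by rewrite !trmx_mul trmxK diagf_tr mulmxA.
move=> v v0; rewrite qform_diagf.
have w_ge0 j : 0 <= w k j by have /andP[] := w01 k j kK.
have term_ge0 j : true -> 0 <= w k j / sigma j ^+ 2 * (Psi^T *m v) j 0 ^+ 2.
  by move=> _; rewrite mulr_ge0 ?sqr_ge0// divr_ge0 ?sqr_ge0.
rewrite lt0r sumr_ge0// andbT psumr_eq0//; apply: contra v0 => /allP H.
have vPW : v^T *m (Psi *m diagf (w 1%N)) = 0.
  apply/rowP => j; rewrite mulmxA mul_mx_diag !mxE.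
  have := H j (mem_index_enum _); rewrite /= mulf_eq0 mulf_eq0 invr_eq0.
  rewrite !expf_eq0/= (gt_eqF (sigma_gt0 j)) orbF => /orP[/eqP wk0|/eqP Pv0].
    suff -> : w 1%N j = 0 by rewrite mulr0.
    have [k1 kK'] := andP kK.
    have := A2 1 k j isT k1 kK'; rewrite wk0 => w1; apply/eqP; rewrite eq_le w1.
    by have /andP[] := w01 1 j K_gt0.
  move: Pv0; rewrite mxE => Pv0; rewrite [X in X * _](_ : _ = 0) ?mul0r//.
  by rewrite -[RHS]Pv0; apply: eq_bigr => i _; rewrite !mxE mulrC.
have : v^T = 0.
  by apply/(row_free_inj A1); rewrite vPW mul0mx.
by move=> /(congr1 trmx); rewrite trmxK trmx0 => ->.
Qed.

Lemma Dmx_Psi k : (1 <= k <= K)%N -> Dmx Psi W k *m Psi^T = 1%:M.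
Proof.
move=> kK; transitivity (invmx (B k) *m B k).
  by rewrite /Dmx /B /Bmx !mulmxA.
by rewrite mulVmx// pos_def_unit//; exact: Bmx_pos_def.
Qed.

Lemma thetat_shift k (y : 'cV[R]_n) th : (1 <= k <= K)%N ->
  thetat Psi W k (Psi^T *m th + y) = th + thetat Psi W k y.
Proof. by move=> kK; rewrite /thetat mulmxDr mulmxA Dmx_Psi// mul1mx. Qed.

Lemma khat_shift y th : khat K Psi W z (Psi^T *m th + y) = khat K Psi W z y.
Proof.
have shift k : (k <= K)%N -> accepted Psi W z k (Psi^T *m th + y) <-> accepted Psi W z k y.
  move=> kK; split=> ak l m l1 lm mk; have := ak l m l1 lm mk;
  by rewrite /test_stat !thetat_shift ?(leq_trans mk)// ?(leq_trans l1 (ltnW lm))//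
    ?l1/= ?(leq_trans (ltnW lm))// ?(leq_trans mk)// opprD addrACA subrr add0r.
have [/andP[k1 kK] ak] := khatP Psi W z K_gt0 y.
have [/andP[k1' kK'] ak'] := khatP Psi W z K_gt0 (Psi^T *m th + y).
apply/eqP; rewrite eqn_leq; apply/andP; split; apply: accepted_le_khat.
- by rewrite k1'.
- exact/(shift _ kK').
- by rewrite k1.
- exact/(shift _ kK).
Qed.

Lemma loss_shift k r y th : (1 <= k <= K)%N ->
  loss K Psi W z k r (Psi^T *m th + y) = loss K Psi W z k r y.
Proof.
move=> kK; rewrite !lossE khat_shift (thetat_shift k y th kK).
have [/andP[k1 khK] _] := khatP Psi W z K_gt0 y; have [k0 _] := andP kK.
have jK : (1 <= minn k (khat K Psi W z y) <= K)%N.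
  by rewrite leq_min k0 k1 (leq_trans (geq_minr _ _) khK).
by rewrite (thetat_shift _ y th jK) opprD addrACA subrr add0r.
Qed.

End estimators.

Section estimators_measurable.
Context {R : realType} {d} {T : measurableType d} {n p : nat} (Psi : 'M[R]_(p, n))
  (W : nat -> 'M[R]_n) (z : nat -> R) (Y : T -> 'cV[R]_n).
Hypothesis mY : forall i, measurable_fun setT (fun t => Y t i 0).

Lemma measurable_mulmx {m} (A : 'M[R]_(m, n)) i :
  measurable_fun setT (fun t => (A *m Y t) i 0).
Proof.
rewrite (_ : (fun t => _) = (fun t => \sum_j A i j * Y t j 0)); last first.
  by apply/funext => t; rewrite mxE.
by apply: measurable_sum => j; apply: measurable_funM.
Qed.

Lemma measurable_qform {m} (A : 'M[R]_m) (V : T -> 'cV[R]_m) :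
  (forall i, measurable_fun setT (fun t => V t i 0)) ->
  measurable_fun setT (fun t => qform A (V t)).
Proof.
move=> mV; rewrite (_ : (fun t => _) =
    (fun t => \sum_j (\sum_i V t i 0 * A i j) * V t j 0)); last first.
  apply/funext => t; rewrite /qform mxE; apply: eq_bigr => j _; congr (_ * _).
  by rewrite mxE; apply: eq_bigr => i _; rewrite mxE.
apply: measurable_sum => j; apply: measurable_funM => //.
by apply: measurable_sum => i; apply: measurable_funM.
Qed.

Lemma measurable_estimator_diff k l i :
  measurable_fun setT (fun t => (thetat Psi W k (Y t) - thetat Psi W l (Y t)) i 0).
Proof.
rewrite (_ : (fun t => _) =
    (fun t => (Dmx Psi W k *m Y t) i 0 - (Dmx Psi W l *m Y t) i 0)); last first.
  by apply/funext => t; rewrite !mxE.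
by apply: measurable_funB; exact: measurable_mulmx.
Qed.

(** Only finitely many pairs [(l, m)] impose a condition; the others contribute
    the whole space to a countable intersection. *)
Lemma measurable_accepted k : measurable [set t | accepted Psi W z k (Y t)].
Proof.
rewrite (_ : [set t | _] = \bigcap_l \bigcap_m
   (if [&& 1 <= l, l < m & m <= k]%N then
      (fun t => test_stat Psi W l m (Y t)) @^-1` [set x | x <= z l] else setT)).
  apply: bigcapT_measurable => l; apply: bigcapT_measurable => m; case: ifP => // _.
  rewrite -[X in measurable X]setTI; apply: measurable_qform => //.
    by move=> i; exact: measurable_estimator_diff.
  by rewrite (_ : [set x | _] = `]-oo, z l]%classic)// set_itvNyc.
apply/seteqP; split => t /=.
  by move=> at_ l _ m _; case: ifP => // /and3P[l1 lm mk]; exact: at_.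
by move=> at_ l m l1 lm mk; have := at_ l Logic.I m Logic.I; rewrite l1 lm mk.
Qed.

Lemma measurable_fiberwise (N : T -> nat) (F : nat -> T -> R) :
  (forall j, measurable [set t | N t = j]) -> (forall j, measurable_fun setT (F j)) ->
  measurable_fun setT (fun t => F (N t) t).
Proof.
move=> mN mF _ A mA; rewrite setTI.
rewrite (_ : _ @^-1` A = \bigcup_j ([set t | N t = j] `&` F j @^-1` A)).
  apply: bigcupT_measurable => j; apply: measurableI => //.
  by rewrite -[X in measurable X]setTI; exact: mF.
apply/seteqP; split => t /=; first by exists (N t).
by move=> [j _ [<-]].
Qed.

End estimators_measurable.

Section loss_measurable.
Context {R : realType} {d} {T : measurableType d} {n p K : nat} (Psi : 'M[R]_(p, n))
  (W : nat -> 'M[R]_n) (z : nat -> R) (Y : T -> 'cV[R]_n).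
Hypothesis K_gt0 : (0 < K)%N.
Hypothesis mY : forall i, measurable_fun setT (fun t => Y t i 0).

(** The selected index is [j] when level [j] is accepted and level [j + 1],
    if it exists, is not. *)
Lemma measurable_khat j : measurable [set t | khat K Psi W z (Y t) = j].
Proof.
pose A k := [set t | accepted Psi W z k (Y t)].
have mA k : measurable (A k) by exact: measurable_accepted.
have [jK|jK] := boolP (1 <= j <= K)%N; last first.
  rewrite (_ : [set t | _] = set0)//; apply/seteqP; split => // t /= tj.
  by have [] := khatP Psi W z K_gt0 (Y t); rewrite tj (negbTE jK).
have [j1 jK'] := andP jK.
rewrite (_ : [set t | _] = A j `\` (if (j < K)%N then A j.+1 else set0)).
  by apply: measurableD => //; case: ifP.
apply/seteqP; split => t /=.
  move=> tj; have [_ ak] := khatP Psi W z K_gt0 (Y t); rewrite tj in ak.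
  split => //; case: ifP => [jltK aj1|_ []].
  have : (j.+1 <= khat K Psi W z (Y t))%N by apply: accepted_le_khat.
  by rewrite tj ltnn.
move=> [aj naj]; apply/eqP; rewrite eqn_leq accepted_le_khat// andbT leqNgt.
apply/negP => jlt; have [/andP[_ kK] ak] := khatP Psi W z K_gt0 (Y t).
by apply: naj; rewrite (leq_trans jlt kK); exact: acceptedW ak.
Qed.

(** The index map [i] covers both the adaptive estimator ([i] the identity) and
    its truncation at [k] ([i] the minimum with [k]). *)
Lemma measurable_loss (i : nat -> nat) k r :
  measurable_fun setT (fun t =>
    `|qform (Bmx Psi W k) (thetat Psi W k (Y t) -
       thetat Psi W (i (khat K Psi W z (Y t))) (Y t))| `^ r).
Proof.
apply: (measurable_fiberwise (fun t => khat K Psi W z (Y t)) (fun j t =>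
  `|qform (Bmx Psi W k) (thetat Psi W k (Y t) - thetat Psi W (i j) (Y t))| `^ r)).
  exact: measurable_khat.
move=> j; apply: measurable_fun_powR; apply: measurableT_comp => //.
by apply: measurable_qform => l; exact: measurable_estimator_diff.
Qed.

End loss_measurable.

(** * The oracle inequality *)

Lemma gaussE_le_cstD {R : realType} {d} {T : measurableType d} (P : probability T R) {n}
    (eps : 'I_n -> {RV P >-> R}) (mu : 'cV[R]_n) (s : 'I_n -> R) (g h : 'cV[R]_n -> R) (c : R) :
    let Y t := mu + diagf s *m (\col_i eps i t) in
    measurable_fun setT (fun t => g (Y t)) -> measurable_fun setT (fun t => h (Y t)) ->
    (forall y, 0 <= g y) -> (forall y, 0 <= h y) -> 0 <= c ->
    (forall y, g y <= c + h y) ->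
  (gaussE eps mu s g <= c%:E + gaussE eps mu s h)%E.
Proof.
move=> Y mg mh g0 h0 c0 gh; rewrite /gaussE unlock.
apply: (@le_trans _ _ (\int[P]_t (c%:E + (h (Y t))%:E))%E).
  apply: ge0_le_integral => //.
  - by move=> t _; rewrite lee_fin.
  - exact/measurable_EFinP.
  - by apply: emeasurable_funD => //; exact/measurable_EFinP.
  - by move=> t _; rewrite -EFinD lee_fin.
rewrite ge0_integralD//.
- by rewrite integral_cst// [X in (_ * X + _)%E](probability_setT P) mule1.
- by move=> t _; rewrite lee_fin.
- exact/measurable_EFinP.
Qed.

(** In the heterogeneous case this amounts to [2 delta (3 - delta) >= 0].  The
    change of measure produces [Delta / (2 (1 - delta))] with coefficient one,
    which is then at most the exponent of the theorem. *)
Lemma varphi_ge1 {R : realType} {n} (s0 s : 'I_n -> R) (delta : R) :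
  0 <= delta < 1 -> 1 <= varphi s0 s delta.
Proof.
move=> /andP[d0 d1]; rewrite /varphi; case: ifP => // _.
rewrite lerBrDr ler_pdivlMr ?exprn_gt0 ?subr_gt0//.
have h : 0 <= 2 * delta * (3 - delta) by rewrite !mulr_ge0// subr_ge0; lra.
rewrite -subr_ge0; apply: le_trans h _; rewrite le_eqVlt; apply/orP; left.
by apply/eqP; ring.
Qed.

Theorem theorem3p3 (R : realType)
  (disp : measure_display) (Omega : measurableType disp)
  (P : probability Omega R)
  (d n p K : nat) (p_gt0 : (0 < p)%N) (p_lt_n : (p < n)%N) (K_gt0 : (0 < K)%N)
  (x : 'cV[R]_d) (X : 'I_n -> 'cV[R]_d) (f : 'cV[R]_d -> R)
  (psi : 'I_p -> 'cV[R]_d -> R)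
  (sigma0 sigma : 'I_n -> R)
  (sigma0_gt0 : forall i, 0 < sigma0 i) (sigma_gt0 : forall i, 0 < sigma i)
  (eps : 'I_n -> {RV P >-> R}) (eps_std : std_gaussian eps)
  (w : nat -> 'I_n -> R)
  (w01 : forall k i, (1 <= k <= K)%N -> 0 <= w k i <= 1)
  (z : nat -> R) (z_gt0 : forall l, (1 <= l < K)%N -> 0 < z l)
  (delta u0 u alpha r : R) (theta : 'cV[R]_p) (Delta : R) :
  let Psi := design_mx psi X x in
  let W := weight_mx sigma w in
  let Sigma := diagf (fun i => sigma i ^+ 2) in
  let fX : 'cV[R]_n := \col_i f (X i) in
  let B := Bmx Psi W in
  let kstar := oracle_index K Psi W Sigma fX theta Delta in
  forall
  (A1 : row_free (Psi *m diagf (w 1%N)))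
  (A2 : forall l k i, (1 <= l)%N -> (l <= k)%N -> (k <= K)%N ->
        w l i <= w k i)
  (delta01 : 0 <= delta < 1)
  (A3 : forall i, 1 - delta <= sigma0 i ^+ 2 / sigma i ^+ 2 <= 1 + delta)
  (u0_u : 1 < u0 <= u)
  (A4 : forall k, (2 <= k <= K)%N ->
        let V := sqrtmx (invmx (B k.-1)) in
        loewner_le u0%:M (V *m B k *m V) /\ loewner_le (V *m B k *m V) u%:M)
  (cov_pos : pos_def (joint_cov Psi W Sigma K))
  (alpha01 : 0 < alpha <= 1) (r_gt0 : 0 < r)
  (PC : forall k, (2 <= k <= K)%N ->
        (gaussE eps 0 sigma (fun y =>
           `|qform (B k) (thetat Psi W k y - theta_hat_k K Psi W z k y)| `^ r)%R
         <= (alpha * chi2_moment p r)%:E)%E)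
  (Delta_ge0 : 0 <= Delta)
  (small_bias : modeling_bias Psi W Sigma fX theta 1 <= Delta),
  (gaussE eps fX sigma0 (fun y =>
     `|qform (B kstar) (thetat Psi W kstar y - theta_hat K Psi W z y)|
       `^ (r / 2))%R
   <= ((if kstar == K then 0 else z kstar `^ (r / 2)) +
       (alpha * chi2_moment p r) `^ (1 / 2) *
       (1 + delta) `^ ((p * kstar)%:R / 4) *
       (1 - delta) `^ (- (3 * (p * kstar)%:R / 4)) *
       expR (varphi sigma0 sigma delta * (Delta / (2 * (1 - delta)))))%:E)%E.
Proof.
move=> Psi W Sigma fX B kstar A1 A2 d01 A3 u0_u A4 cov_pos alpha01 r_gt0 PC D0 small_bias.
have [d0 d1] := andP d01.
have ks_pos : (0 < kstar)%N.
  by apply: (leq_bigmax_seq (F := fun i => i)); rewrite ?mem_index_iota.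
have := bigmax_nat_attained _ _ ks_pos.
rewrite -/(oracle_index _ _ _ _ _ _ _) -/kstar mem_index_iota ltnS => -[ksK bias_ks].
have [_ ks_le] := andP ksK.
pose hk := khat K Psi W z.
pose g y := `|qform (B kstar) (thetat Psi W kstar y - theta_hat K Psi W z y)| `^ (r / 2).
pose L q := loss K Psi W z kstar q.
have LE q y : L q y =
  `|qform (B kstar) (thetat Psi W kstar y - thetat Psi W (minn kstar (hk y)) y)| `^ q by [].
have L0 q y : 0 <= L q y by exact: powR_ge0.
pose zt := if kstar == K then 0 else z kstar `^ (r / 2).
have zt0 : 0 <= zt by rewrite /zt; case: ifP => // _; exact: powR_ge0.
(* Either the selected index is at most [kstar] and the two losses agree, or
   the pair (kstar, selected index) has passed its test. *)
have g_le y : g y <= zt + L (r / 2) y.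
  rewrite LE /g /theta_hat -/(hk y).
  have [/andP[k1 kK] acc] := khatP Psi W z K_gt0 y.
  have [le_k|lt_k] := leqP (hk y) kstar.
    by rewrite lerDr.
  rewrite /zt ltn_eqF ?(leq_trans lt_k)//.
  rewrite -[leLHS]addr0; apply: lerD; last exact: powR_ge0.
  have qge0 : 0 <= qform (B kstar) (thetat Psi W kstar y - thetat Psi W (hk y) y).
    apply: pos_def_qform_ge0.
    exact: (Bmx_pos_def Psi sigma w sigma_gt0 w01 A1 A2 K_gt0 kstar ksK).
  have r20 : 0 <= r / 2 by rewrite divr_ge0// ltW.
  rewrite ger0_norm//; apply: (ge0_ler_powR r20).
  - by rewrite nnegrE.
  - by rewrite nnegrE ltW// z_gt0// ks_pos (leq_trans lt_k).
  - exact: acc.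
pose Y0 t : 'cV[R]_n := fX + diagf sigma0 *m (\col_i eps i t).
have mY0 i : measurable_fun setT (fun t => Y0 t i 0).
  rewrite (_ : (fun t => _) = (fun t => fX i 0 + sigma0 i * eps i t)); last first.
    by apply/funext => t; rewrite [LHS]mxE mul_diag_mx [in X in _ + X]mxE !mxE.
  by apply: measurable_funD => //; apply: measurable_funM.
have mg : measurable_fun setT (fun t => g (Y0 t)).
  exact: (measurable_loss Psi W z Y0 K_gt0 mY0 id kstar (r / 2)).
have mL : measurable_fun setT (fun t => L (r / 2) (Y0 t)).
  exact: (measurable_loss Psi W z Y0 K_gt0 mY0 (minn kstar) kstar (r / 2)).
apply: (le_trans (gaussE_le_cstD P eps fX sigma0 g (L (r / 2)) zt mg mL
  (fun y => powR_ge0 _ _) (L0 _) zt0 g_le)).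
rewrite EFinD; apply: leeD => //.
have [ks1|ks1] := eqVneq kstar 1%N.
  have L1 y : L (r / 2) y = 0.
    have [/andP[k1 kK] _] := khatP Psi W z K_gt0 y.
    rewrite LE ks1 (minn_idPl k1) subrr /qform mulmx0 mxE normr0 powR0//.
    by rewrite mulf_neq0 ?invr_eq0// gt_eqF.
  rewrite /gaussE unlock; under eq_integral do rewrite L1.
  by rewrite integral0 lee_fin !mulr_ge0 ?powR_ge0 ?expR_ge0.
have ks2 : (2 <= kstar <= K)%N by rewrite ks_le andbT ltn_neqAle eq_sym ks1.
pose a := alpha * chi2_moment p r.
have La : (gaussE eps (Psi^T *m theta) sigma (L r) <= a%:E)%E.
  have <- : gaussE eps 0 sigma (L r) = gaussE eps (Psi^T *m theta) sigma (L r).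
    rewrite /gaussE unlock; apply: eq_integral => t _.
    rewrite add0r /L.
    by rewrite (loss_shift Psi sigma w z sigma_gt0 w01 A1 A2 K_gt0 kstar r _ theta ksK).
  exact: PC.
pose D := stacked_D Psi W kstar.
have posS : pos_def (D *m diagf (fun i => sigma i ^+ 2) *m D^T).
  rewrite -joint_covE; exact: joint_cov_pos_def cov_pos.
have mLr : measurable_fun setT (fun x : n.-tuple R => L r (\col_i tnth x i)).
  apply: (measurable_loss Psi W z (fun x : n.-tuple R => \col_i tnth x i)
    K_gt0 _ (minn kstar) kstar r) => i.
  by under eq_fun do rewrite mxE; exact: measurable_tnth.
have Lext y y' : D *m y = D *m y' -> L r y = L r y'.
  exact: (loss_ext Psi W z kstar r y y' K_gt0 ksK).
have := gaussE_change_of_measure P eps sigma sigma0 delta a D fX (Psi^T *m theta) (L r)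
  eps_std sigma_gt0 sigma0_gt0 d01 A3 posS mLr (L0 r) Lext La.
have -> : (fun y => L r y `^ (1 / 2)) = L (r / 2).
  by apply/funext => y; rewrite !LE -powRrM mul1r.
move=> /le_trans; apply.
rewrite lee_fin -/a -!mulrA ler_wpM2l ?powR_ge0// mulrA.
apply: ler_pM; rewrite ?powR_ge0 ?expR_ge0//.
  rewrite (_ : (\sum_(l < kstar) p)%N = (p * kstar)%N); last first.
    by rewrite sum_nat_const card_ord mulnC.
  have dd : 0 < 1 - delta by rewrite subr_gt0.
  have -> : ((1 - delta) ^+ 3)^-1 = (1 - delta) `^ (- 3%:R).
    by rewrite powRN powR_mulrn// ltW.
  rewrite powRM ?powR_ge0//; last by lra.
  by rewrite -powRrM mulNr.
rewrite ler_expR.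
have biasE : qform (invmx (D *m diagf (fun i => sigma i ^+ 2) *m D^T))
    (D *m (fX - Psi^T *m theta)) = modeling_bias Psi W Sigma fX theta kstar.
  rewrite /modeling_bias joint_covE; congr (qform _ _).
  rewrite mxcol_mul /joint_bias; apply: eq_mxcol => l; rewrite mulmxBr mulmxA.
  rewrite (Dmx_Psi Psi sigma w sigma_gt0 w01 A1 A2 K_gt0) ?mul1mx//.
  exact: leq_trans ks_le.
rewrite biasE.
have c0 : 0 < 2 * (1 - delta) by rewrite mulr_gt0// subr_gt0.
apply: (@le_trans _ _ (Delta / (2 * (1 - delta)))).
  by rewrite ler_pM2r ?invr_gt0.
by rewrite ler_peMl ?varphi_ge1// divr_ge0// ltW.
Qed.
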